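(* Selective Clique Partition parameterized by the treewidth of the input graph and the number $p$ of parts of the partition is fixed-parameter tractable: there is an algorithm that decides an instance $(G,\mathcal{V},k)$ in time $g(\mathrm{tw}(G),p)\cdot |V(G)|^{O(1)}$ for some computable function $g$.
   Context: Selective Clique Partition: given a graph $G$, a partition $\mathcal{V}$ of $V(G)$ into $p$ parts, and an integer $k$, decide whether there is a set $X\subseteq V(G)$ containing exactly one vertex of each part of $\mathcal{V}$ such that $X$ can be partitioned into at most $k$ cliques of $G$ (equivalently, the complement of $G[X]$ is $k$-colorable). $\mathrm{tw}(G)$ denotes the treewidth of $G$. *)

(* Defs.v *)
From HB Require Import structures.
From mathcomp Require Import all_boot.
From mathcomp Require Import boolp.

Set Implicit Arguments.
Unset Strict Implicit.
Unset Printing Implicit Defensive.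

Record sgraph (T : finType) := SGraph {
  edge :> rel T;
  edge_sym : symmetric edge;
  edge_irr : irreflexive edge
}.

Definition clique (T : finType) (G : sgraph T) (C : {set T}) : bool :=
  [forall x in C, forall y in C, (x != y) ==> G x y].

(* The condition [2 < size c] is needed: in a symmetric graph every edge gives
   a duplicate-free closed walk of length 2. *)
Definition acyclic (T : finType) (G : sgraph T) : Prop :=
  forall c : seq T, 2 < size c -> ~ ucycle G c.

Definition is_tree (T : finType) (G : sgraph T) : Prop :=
  [/\ 0 < #|T|, forall x y, connect G x y & acyclic G].

Record is_tree_decomposition (V : finType) (G : sgraph V)
    (T : finType) (F : sgraph T) (bag : T -> {set V}) : Prop := {
  td_tree : is_tree F;
  td_vertex : forall v, exists t, v \in bag t;
  td_edge : forall u v, G u v -> exists t, (u \in bag t) && (v \in bag t);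
  (* the nodes whose bag contains v induce a connected subgraph of F *)
  td_connected : forall v s t, v \in bag s -> v \in bag t ->
    connect [rel a b | [&& v \in bag a, v \in bag b & F a b]] s t
}.

(* The predecessor is truncated, so a decomposition with only empty bags has
   width 0 instead of -1; this affects only the graph without vertices. *)
Definition td_width (V T : finType) (bag : T -> {set V}) : nat :=
  (\max_(t : T) #|bag t|).-1.

Definition has_td_of_width (V : finType) (G : sgraph V) (w : nat) : Prop :=
  exists (T : finType) (F : sgraph T) (bag : T -> {set V}),
    is_tree_decomposition G F bag /\ td_width bag = w.

Lemma treewidth_subproof (V : finType) (G : sgraph V) :
  exists w, `[< has_td_of_width G w >].
Proof.
exists (td_width (fun _ : unit => [set: V])); apply/asboolP.
have Fsym : symmetric (fun _ _ : unit => false) by [].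
have Firr : irreflexive (fun _ : unit => fun _ : unit => false) by [].
exists unit, (SGraph Fsym Firr), (fun _ => [set: V]); split=> //; split.
- split; first by rewrite card_unit.
  + by move=> [] []; apply: connect0.
  + by move=> [|[] [|[] c]] //= _; rewrite /ucycle.
- by move=> v; exists tt; rewrite inE.
- by move=> u v _; exists tt; rewrite !inE.
- by move=> v [] [] _ _; apply: connect0.
Qed.

Definition treewidth (V : finType) (G : sgraph V) : nat :=
  ex_minn (treewidth_subproof G).

(* The parts are listed in the (arbitrary) order in which the input gives them;
   MathComp's [partition] excludes the empty part. *)
Record scp_instance := SCPInstance {
  scp_n : nat;
  scp_graph : sgraph 'I_scp_n;
  scp_parts : seq {set 'I_scp_n};
  scp_k : nat;
  scp_parts_uniq : uniq scp_parts;
  scp_parts_partition : partition [set:: scp_parts] [set: 'I_scp_n]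
}.

Definition scp_p (I : scp_instance) : nat := size (scp_parts I).

(* [is_transversal] says that X meets each part in exactly one vertex. *)
Definition scp_yes (I : scp_instance) : bool :=
  [exists X : {set 'I_(scp_n I)},
     is_transversal X [set:: scp_parts I] [set: 'I_(scp_n I)] &&
     [exists Q : {set {set 'I_(scp_n I)}},
        [&& partition Q X, #|Q| <= scp_k I &
            [forall C in Q, clique (scp_graph I) C]]]].

(* n, p and k, the adjacency matrix of the graph row by row, and then the
   characteristic vector of each part. *)
Definition scp_encode (I : scp_instance) : seq nat :=
  [:: scp_n I; scp_p I; scp_k I] ++
  [seq nat_of_bool (scp_graph I x y)
     | x <- enum 'I_(scp_n I), y <- enum 'I_(scp_n I)] ++
  [seq nat_of_bool (x \in B)
     | B : {set 'I_(scp_n I)} <- scp_parts I, x : 'I_(scp_n I) <- enum 'I_(scp_n I)].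

(* Random access machines with a finite program, over natural numbers, in the
   unit-cost measure.  The only arithmetic is addition and truncated
   subtraction, so that the length of the numbers grows by at most one bit per
   step and the running time is polynomially related to that of a Turing
   machine.  Registers are addressed by constants of the program, memory cells
   by the contents of registers. *)
Inductive instr :=
  | IConst of nat & nat         (* r_i := c *)
  | IAdd of nat & nat & nat     (* r_i := r_j + r_l *)
  | ISub of nat & nat & nat     (* r_i := r_j - r_l *)
  | ILoad of nat & nat          (* r_i := mem[r_j] *)
  | IStore of nat & nat         (* mem[r_i] := r_j *)
  | IJumpz of nat & nat.        (* if r_i = 0 then jump to instruction a *)

Definition program := seq instr.

Record config := Config {
  pc : nat;
  reg : nat -> nat;
  mem : nat -> nat
}.

Definition update (f : nat -> nat) (i v : nat) : nat -> nat :=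
  fun j => if j == i then v else f j.

Definition exec (ins : instr) (s : config) : config :=
  let: Config a r m := s in
  match ins with
  | IConst i c => Config a.+1 (update r i c) m
  | IAdd i j l => Config a.+1 (update r i (r j + r l)) m
  | ISub i j l => Config a.+1 (update r i (r j - r l)) m
  | ILoad i j => Config a.+1 (update r i (m (r j))) m
  | IStore i j => Config a.+1 r (update m (r i) (r j))
  | IJumpz i b => Config (if r i == 0 then b else a.+1) r m
  end.

(* The machine halts when the program counter leaves the program; a halted
   configuration is a fixed point of [step]. *)
Definition halted (P : program) (s : config) : bool := size P <= pc s.

Definition step (P : program) (s : config) : config :=
  if onth P (pc s) is Some ins then exec ins s else s.

(* The input is stored in the first memory cells; all the other cells and all
   the registers are 0. *)
Definition init (input : seq nat) : config :=
  Config 0 (fun _ => 0) (fun a => nth 0 input a).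

(* P halts on the input after at most t steps, with the output in r_0. *)
Definition outputs_within (P : program) (input : seq nat) (t out : nat) : Prop :=
  let s := iter t (step P) (init input) in halted P s /\ reg s 0 = out.

Definition computable2 (g : nat -> nat -> nat) : Prop :=
  exists P : program, forall a b : nat, exists t : nat,
    outputs_within P [:: a; b] t (g a b).

(* The maximum matters only for n = 0, where n ^ c would allow no step. *)
Definition scp_time (g : nat -> nat -> nat) (c : nat) (I : scp_instance) : nat :=
  g (treewidth (scp_graph I)) (scp_p I) * maxn 1 (scp_n I) ^ c.

(* Main.v *)
Require Import Defs.
From mathcomp Require Import all_boot.
From mathcomp Require Import boolp zify.
Set Implicit Arguments.
Unset Strict Implicit.
Unset Printing Implicit Defensive.

(** A solution is a partition of the set of parts into at most k groups,
    together with a clique meeting each part of a group exactly once; cliques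
    chosen for distinct groups do not interact.  Give a vertex of part i the
    weight 4^p + 2^i.  A family of cliques has total weight
    p 4^p + (2^p - 1) iff it has p vertices (with multiplicity) whose powers
    2^i sum to 2^p - 1, and p powers of two have that sum only if every
    exponent below p occurs once.  So the instance is a knapsack problem:
    reach this target with at most k clique weights.

    In a graph of treewidth w there are at most n 2^(w+1) + 1 cliques, since a
    nonempty clique lies in the bag of the highest node of one of its vertices
    (in a rooted tree decomposition).  Listing them by adding the vertices one
    at a time and filling the knapsack table takes time 2^(w + 3p + O(1)) n^3. *)

(** * Structured programs for the machine *)

Definition store := ((nat -> nat) * (nat -> nat))%type.

Inductive cmd :=
  | Do of seq instr
  | Seq of cmd & cmd
  | If of nat & cmd
  | While of nat & cmd.

Notation "c1 ;; c2" := (Seq c1 c2) (at level 60, right associativity).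

(* Register 1 is scratch: a loop clears it to jump back unconditionally. *)
Fixpoint compile (a : nat) (c : cmd) : seq instr :=
  match c with
  | Do l => l
  | c1 ;; c2 => let l := compile a c1 in l ++ compile (a + size l) c2
  | If r c => let l := compile a.+1 c in IJumpz r (a.+1 + size l) :: l
  | While r c => let l := compile a.+1 c in
      IJumpz r (a + size l).+3 :: l ++ [:: IConst 1 0; IJumpz 1 a]
  end.

Definition is_jump (i : instr) : bool := if i is IJumpz _ _ then true else false.

(* [eqn] rather than [==], so that blocks of instructions can be executed by [cbv]. *)
Definition set_reg (r : nat -> nat) (i v : nat) : nat -> nat :=
  fun j => if eqn j i then v else r j.

Lemma set_regE (r : nat -> nat) i v j : set_reg r i v j = if j == i then v else r j.
Proof. by []. Qed.

Lemma set_reg_update : set_reg = update.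
Proof. by []. Qed.

Definition exec_store (s : store) (i : instr) : store :=
  let (r, m) := s in
  match i with
  | IConst i c => (set_reg r i c, m)
  | IAdd i j l => (set_reg r i (r j + r l), m)
  | ISub i j l => (set_reg r i (r j - r l), m)
  | ILoad i j => (set_reg r i (m (r j)), m)
  | IStore i j => (r, update m (r i) (r j))
  | IJumpz _ _ => (r, m)
  end.

(** The number counts machine steps exactly. A [While] round costs three steps besides its body: the
    test, the clearing of register 1 and the jump back. The clearing is visible in the store. *)
Inductive run : cmd -> store -> nat -> store -> Prop :=
  | RunDo l s of ~~ has is_jump l : run (Do l) s (size l) (foldl exec_store s l)
  | RunSeq c1 c2 s t1 s1 t2 s2 of run c1 s t1 s1 & run c2 s1 t2 s2 :
      run (c1 ;; c2) s (t1 + t2) s2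
  | RunIf0 r c s of s.1 r = 0 : run (If r c) s 1 s
  | RunIf r c s t s1 of s.1 r != 0 & run c s t s1 : run (If r c) s t.+1 s1
  | RunWhile0 r c s of s.1 r = 0 : run (While r c) s 1 s
  | RunWhile r c s t1 s1 t2 s2 of s.1 r != 0 & run c s t1 s1
      & run (While r c) (set_reg s1.1 1 0, s1.2) t2 s2 :
      run (While r c) s (t1 + t2).+3 s2.

Definition conf (a : nat) (s : store) : config := Config a s.1 s.2.

Lemma step_conf (P pre post : seq instr) i s :
  P = pre ++ i :: post -> step P (conf (size pre) s) = exec i (conf (size pre) s).
Proof.
by move=> ->; rewrite /step /= onth_cat ltnn subnn.
Qed.

Lemma run_do (l : seq instr) (P pre post : seq instr) s :
  ~~ has is_jump l -> P = pre ++ l ++ post ->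
  iter (size l) (step P) (conf (size pre) s)
  = conf (size pre + size l) (foldl exec_store s l).
Proof.
elim: l pre s => [|i l IHl] pre s; first by rewrite addn0.
rewrite /= negb_or => /andP[Hi Hl] EP.
rewrite -iterS iterSr (step_conf s EP).
have -> : exec i (conf (size pre) s) = conf (size (rcons pre i)) (exec_store s i).
  by rewrite size_rcons; case: s i Hi {EP} => a b []; rewrite //= set_reg_update.
rewrite (IHl (rcons pre i)) //; last by rewrite cat_rcons.
by rewrite size_rcons addSnnS.
Qed.

(** Jump targets are absolute, so the code is placed at address [size pre] of an arbitrary program.
    The induction on the run enlarges [pre] by the instructions already passed. *)
Lemma run_compile c s t s' : run c s t s' -> forall P pre post,
  P = pre ++ compile (size pre) c ++ post ->
  iter t (step P) (conf (size pre) s)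
  = conf (size pre + size (compile (size pre) c)) s'.
Proof.
elim=> {c s t s'} [l s Hl|c1 c2 s t1 s1 t2 s2 _ IH1 _ IH2|r c s r0|
  r c s t s1 r0 _ IH|r c s r0|r c s t1 s1 t2 s2 r0 _ IH1 _ IH2] P pre post EP.
- exact: run_do EP.
- rewrite addnC iterD (IH1 P pre (compile (size pre + size (compile (size pre) c1)) c2 ++ post)).
    rewrite -size_cat (IH2 P _ post); first by rewrite /= !size_cat addnA.
    by rewrite EP /= size_cat !catA.
  by rewrite EP /= -!catA.
- by rewrite /= (step_conf _ EP) /= r0 /conf /= addSnnS.
- rewrite iterSr (step_conf _ EP) /= (negPf r0).
  have:= IH P (rcons pre (IJumpz r ((size pre).+1 + size (compile (size pre).+1 c)))) post.
  rewrite size_rcons /conf /= => -> //; first by rewrite addSnnS.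
  by rewrite EP /= cat_rcons.
- rewrite /= (step_conf _ EP) /= r0 /conf /= size_cat /= addn2 !addnS; congr Config.
- set l := compile (size pre).+1 c.
  (* The same program is split at the test, at the clearing of register 1 and at the jump back, the
     three steps of a round outside its body. *)
  have EP0 : P = pre ++ IJumpz r (size pre + size l).+3 :: l ++
      [:: IConst 1 0, IJumpz 1 (size pre) & post] by rewrite EP /= -catA.
  have EP1 : P = (pre ++ IJumpz r (size pre + size l).+3 :: l) ++
      IConst 1 0 :: (IJumpz 1 (size pre) :: post) by rewrite EP0 -catA.
  have EP2 : P = (pre ++ IJumpz r (size pre + size l).+3 :: rcons l (IConst 1 0)) ++
      IJumpz 1 (size pre) :: post by rewrite EP0 -catA /= cat_rcons.
  rewrite iterSr (step_conf _ EP0).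
  have -> : exec (IJumpz r (size pre + size l).+3) (conf (size pre) s) = conf (size pre).+1 s.
    by rewrite /= (negPf r0).
  rewrite -2!addnS addnC iterD.
  have := IH1 P (rcons pre (IJumpz r (size pre + size l).+3))
    [:: IConst 1 0, IJumpz 1 (size pre) & post].
  rewrite size_rcons cat_rcons -/l => -> //.
  have -> : (size pre).+1 + size l = size (pre ++ IJumpz r (size pre + size l).+3 :: l).
    by rewrite size_cat addSnnS.
  rewrite iterSr (step_conf _ EP1) iterSr.
  have -> : exec (IConst 1 0) (conf (size (pre ++ IJumpz r (size pre + size l).+3 :: l)) s1)
      = conf (size (pre ++ IJumpz r (size pre + size l).+3 :: rcons l (IConst 1 0)))
          (set_reg s1.1 1 0, s1.2).
    by rewrite /= set_reg_update /conf !size_cat /= size_rcons !addnS.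
  rewrite (step_conf _ EP2) -(IH2 P pre post EP).
  by congr iter.
Qed.

(** A syntactic upper bound for the registers written. [While] contributes register 1, which its
    back jump clears. *)
Fixpoint mods (c : cmd) : seq nat :=
  match c with
  | Do l => pmap (fun i => match i with
      | IConst r _ | IAdd r _ _ | ISub r _ _ | ILoad r _ => Some r
      | _ => None end) l
  | c1 ;; c2 => mods c1 ++ mods c2
  | If _ c => mods c
  | While _ c => 1 :: mods c
  end.

Definition frame (l : seq nat) (s s' : store) : Prop :=
  forall r, r \notin l -> s'.1 r = s.1 r.

Lemma run_frame c s t s' : run c s t s' -> frame (mods c) s s'.
Proof.
rewrite /frame; elim=> {c s t s'} //=.
- move=> l s _ r; elim: l s => [|i l IHl] s //=.
  case: i => [a b|a b d|a b d|a b|a b|a b] /=; try (by case: s => u w; exact: IHl);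
    by rewrite inE negb_or => /andP[/negPf ra Hr]; rewrite IHl //;
    case: s => u w; rewrite /= set_regE ra.
- move=> c1 c2 s t1 s1 t2 s2 _ IH1 _ IH2 r.
  by rewrite mem_cat negb_or => /andP[H1 H2]; rewrite IH2 ?IH1.
- move=> r c s t1 s1 t2 s2 _ _ IH1 _ IH2 x Hx.
  rewrite IH2 //= set_regE.
  by move: Hx; rewrite inE negb_or => /andP[/negPf-> Hx]; rewrite IH1.
Qed.

(** Total correctness with a time budget: termination and the bound [T] are part of the triple. *)
Definition wp (c : cmd) (s : store) (T : nat) (Q : store -> Prop) : Prop :=
  exists t s', [/\ run c s t s', t <= T & Q s'].

(** Lets a specification list only what a command changes; the other registers are recovered from
    [mods]. *)
Lemma wp_frame c s T Q :
  wp c s T Q -> wp c s T (fun s' => frame (mods c) s s' /\ Q s').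
Proof.
by move=> [t [s' [H1 H2 H3]]]; exists t, s'; split=> //; split=> //; exact: run_frame H1.
Qed.

Lemma wp_weaken c s T T' (Q Q' : store -> Prop) :
  wp c s T Q -> T <= T' -> (forall s', Q s' -> Q' s') -> wp c s T' Q'.
Proof.
move=> [t [s' [H1 H2 H3]]] HT HQ; exists t, s'; split; [exact: H1|lia|exact: HQ].
Qed.

Lemma wp_do l s T (Q : store -> Prop) :
  ~~ has is_jump l -> size l <= T -> Q (foldl exec_store s l) -> wp (Do l) s T Q.
Proof. by move=> H1 H2 H3; exists (size l), (foldl exec_store s l); split=> //; constructor. Qed.

Lemma wp_seq T1 T2 (R : store -> Prop) c1 c2 s T Q :
  wp c1 s T1 R -> T1 + T2 <= T -> (forall s1, R s1 -> wp c2 s1 T2 Q) -> wp (c1 ;; c2) s T Q.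
Proof.
move=> [t1 [s1 [H1 Ht1 HR]]] HT H; have [t2 [s2 [H2 Ht2 HQ]]] := H _ HR.
exists (t1 + t2), s2; split=> //; [exact: RunSeq H1 H2|lia].
Qed.

Lemma wp_doseq l c s T (Q : store -> Prop) :
  ~~ has is_jump l -> size l <= T ->
  wp c (foldl exec_store s l) (T - size l) Q -> wp (Do l ;; c) s T Q.
Proof.
move=> H1 H2 H3; apply: (@wp_seq (size l) (T - size l) (eq (foldl exec_store s l))).
- exact: wp_do.
- lia.
- by move=> _ <-.
Qed.

Lemma wp_if r c s T (Q : store -> Prop) :
  (s.1 r = 0 -> Q s) -> (s.1 r != 0 -> wp c s T Q) -> wp (If r c) s T.+1 Q.
Proof.
move=> H0 H1; have [E|E] := eqVneq (s.1 r) 0.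
  by exists 1, s; split; [constructor| |exact: H0].
have [t [s1 [Hr Ht HQ]]] := H1 E.
by exists t.+1, s1; split=> //; constructor.
Qed.

(** A loop counting [r] down to 0; register 1 holds the constant 1 for the decrement. *)
Definition loop (r : nat) (c : cmd) : cmd :=
  While r (c ;; Do [:: IConst 1 1; ISub r r 1]).

(** The invariant is indexed by the number of remaining rounds and is asserted after the decrement
    and the back jump. A round costs [B] for the body, 2 for the decrement and 3 for [While]; the
    last, failing test costs 1. *)
Lemma wp_loop (I : nat -> store -> Prop) (B r : nat) (c : cmd) s T :
  let L := 1 :: mods c in
  r \notin L ->
  I (s.1 r) s ->
  (forall m s1, m < s.1 r -> s1.1 r = m.+1 -> frame (r :: L) s s1 -> I m.+1 s1 ->
     wp c s1 B (fun s2 => I m (set_reg (set_reg (set_reg s2.1 1 1) r m) 1 0, s2.2))) ->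
  s.1 r * (B + 5) + 1 <= T ->
  wp (loop r c) s T (fun s' => [/\ s'.1 r = 0, frame (r :: L) s s' & I 0 s']).
Proof.
move=> L rL Is step; rewrite /loop.
have r1 : (r == 1) = false by apply: contraNF rL => /eqP->; rewrite inE.
suff H m s1 : m <= s.1 r -> s1.1 r = m -> frame (r :: L) s s1 -> I m s1 ->
  exists t s', [/\ run (loop r c) s1 t s', t <= m * (B + 5) + 1 &
    [/\ s'.1 r = 0, frame (r :: L) s s' & I 0 s']].
  move=> HT; have [|t [s' [H1 H2 H3]]] := H _ s (leqnn _) erefl _ Is; first by [].
  by exists t, s'; split=> //; lia.
elim: m s1 => [|m IHm] s1 Hm E fr Im.
  by exists 1, s1; split; [constructor| |].
have [t [s2 [H1 H2 H3]]] := step m s1 Hm E fr Im.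
have E2 : s2.1 r = m.+1.
  by rewrite (run_frame H1) //; move: rL; rewrite inE negb_or => /andP[].
have [|||t' [s3 [H4 H5 H6]]] := IHm _ _ _ _ H3.
- exact: ltnW.
- by rewrite /= !set_regE r1 eqxx.
- move=> x xL; move: (xL); rewrite !inE !negb_or => /and3P[xr x1 xc].
  rewrite /= !set_regE (negPf x1) (negPf xr) (run_frame H1 xc); exact: fr.
exists ((t + 2) + t').+3, s3; split=> //; last by lia.
have Hb : run (c ;; Do [:: IConst 1 1; ISub r r 1]) s1 (t + 2)
    (set_reg (set_reg s2.1 1 1) r m, s2.2).
  apply: RunSeq H1 _; have := @RunDo [:: IConst 1 1; ISub r r 1] s2 isT.
  by case: (s2) E2 => a b /= E2; rewrite !set_regE r1 /= E2 subn1.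
by apply: RunWhile Hb H4; rewrite E.
Qed.

(** A run may end before the budget [t]; the remaining steps change nothing, because a halted
    configuration is a fixed point of [step]. *)
Lemma wp_outputs c input t out :
  wp c (fun _ => 0, nth 0 input) t (fun s => s.1 0 = out) ->
  outputs_within (compile 0 c) input t out.
Proof.
move=> [t' [s' [H1 H2 H3]]]; rewrite /outputs_within.
have E := run_compile H1 (P := compile 0 c) (pre := [::]) (post := [::]) (esym (cats0 _)).
have haltK m s : halted (compile 0 c) s -> iter m (step (compile 0 c)) s = s.
  move=> Hs; elim: m => //= m ->; rewrite /step.
  by case: s Hs => a r mm; rewrite /halted /= => Ha; rewrite onth_default.
rewrite -(subnK H2) iterD.
rewrite -[init input]/(conf (size (Nil instr)) (fun _ => 0, nth 0 input)) E.
by rewrite haltK; rewrite /halted /= add0n.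
Qed.

(** * The algorithm and its running time *)

Definition copy (i j : nat) : seq instr := [:: IConst i 0; IAdd i i j].

Lemma exec_pair (s : store) l : foldl exec_store s l = foldl exec_store (s.1, s.2) l.
Proof. by rewrite -surjective_pairing. Qed.

Ltac exec_simpl :=
  try match goal with |- context [foldl exec_store ?s ?l] =>
    let l' := eval unfold copy in l in
    let l' := eval simpl in l' in
    rewrite (exec_pair s l);
    let t := constr:(foldl exec_store (s.1, s.2) l') in
    let v := eval cbv [foldl exec_store set_reg eqn] in t in
    change (foldl exec_store (s.1, s.2) l) with v
  end; rewrite /= ?set_regE /=.

Ltac block := apply: wp_doseq; [by [] | by rewrite /copy /=; lia | ].

(* Registers: 2 = n, 3 = p, 4 = k, 5 = 4^p, 6 = address of the part vectors,
   7 = end of the input and start of the list of cliques, 8 = target weight,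
   9 and 10 = addresses of the adjacency row and of the first part entry of the
   current vertex v, 11 = weight of v, 13 = end of the list, 14 = its length,
   15 = n + 1, the size of its records, 22 = v + 1, 27 = current table cell;
   12 holds powers of 2, 16 to 18 are loop counters, the others temporaries. *)
Definition setup : cmd :=
  Do ([:: IConst 19 0; ILoad 2 19; IConst 19 1; ILoad 3 19; IConst 19 2; ILoad 4 19;
      IConst 6 3] ++ copy 16 2) ;;
  loop 16 (Do [:: IAdd 6 6 2]) ;;
  Do (copy 7 6 ++ [:: IConst 5 1; IConst 12 1] ++ copy 16 3) ;;
  loop 16 (Do [:: IAdd 7 7 2; IAdd 5 5 5; IAdd 5 5 5; IAdd 12 12 12]) ;;
  Do (copy 8 12 ++ [:: IConst 19 1; ISub 8 8 19] ++ copy 16 3) ;;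
  loop 16 (Do [:: IAdd 8 8 5]).

Definition target p := p * 4 ^ p + (2 ^ p).-1.

(** With addition and subtraction only, the products are accumulated by repeated addition and the
    powers by repeated doubling, in one loop of n rounds and two of p rounds. *)
Lemma wp_setup (s : store) n p k :
  s.2 0 = n -> s.2 1 = p -> s.2 2 = k ->
  wp setup s (40 + n * 6 + p * 20) (fun s' =>
    [/\ s'.2 = s.2, s'.1 2 = n, s'.1 3 = p & s'.1 4 = k] /\
    [/\ s'.1 5 = 4 ^ p, s'.1 6 = 3 + n * n, s'.1 7 = 3 + n * n + p * n &
        s'.1 8 = target p]).
Proof.
move=> En Ep Ek; rewrite /setup.
block.
set s0 := foldl _ _ _.
have [F0 F1] : (s0.2 = s.2 /\ [/\ s0.1 2 = n, s0.1 3 = p & s0.1 4 = k]) /\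
    (s0.1 6 = 3 /\ s0.1 16 = n) by rewrite /s0; exec_simpl; rewrite En Ep Ek.
clearbody s0; case: F0 => M0 [R2 R3 R4]; case: F1 => R6 R16.
apply: (@wp_seq (n * 6 + 1) (30 + p * 20)); [| |].
- apply: (wp_loop (I := fun m s1 => s1.2 = s.2 /\ s1.1 6 + m * n = 3 + n * n) (B := 1)).
  + by [].
  + by rewrite M0 R6 R16.
  + move=> m s1 _ _ fr [E2 E6]; apply: wp_do => //; exec_simpl; split=> //.
    rewrite (fr 2) // R2; lia.
  + rewrite R16; lia.
- rewrite /copy /=; lia.
move=> s1 [_ fr [M1 E6]].
have {}E6 : s1.1 6 = 3 + n * n by lia.
move: (fr 2) (fr 3) (fr 4); rewrite R2 R3 R4 => {fr} /(_ isT) E2 /(_ isT) E3 /(_ isT) E4.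
block.
set s2 := foldl _ _ _.
have : [/\ s2.2 = s.2, s2.1 2 = n, s2.1 3 = p, s2.1 4 = k & s2.1 6 = 3 + n * n] /\
   [/\ s2.1 7 = 3 + n * n, s2.1 5 = 1, s2.1 12 = 1 & s2.1 16 = p].
  by rewrite /s2; exec_simpl.
clearbody s2 => {M0 R2 R3 R4 R6 R16 s0 M1 E2 E3 E4 E6 s1}.
move=> [[M1 E2 E3 E4 E6] [E7 E5 E12 E16]].
apply: (@wp_seq (p * 9 + 1) (20 + p * 8)).
- apply: (wp_loop (I := fun m s1 => [/\ s1.2 = s.2, m <= p,
    s1.1 7 = 3 + n * n + (p - m) * n, s1.1 5 = 4 ^ (p - m) & s1.1 12 = 2 ^ (p - m)]) (B := 4)).
  + by [].
  + by rewrite E16 subnn addn0; split.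
  + move=> m s1 _ _ fr [M mp E7' E5' E12']; apply: wp_do => //; exec_simpl.
    rewrite (fr 2) // E2 E7' E5' E12' (_ : p - m = (p - m.+1).+1); last by lia.
    rewrite !expnS mulSn; split=> //; try lia.
  + rewrite E16; lia.
- rewrite /copy /=; lia.
move=> s1 [_ fr [M _ E7' E5' E12']].
rewrite subn0 in E7' E5' E12'.
move: (fr 2) (fr 3) (fr 4) (fr 6); rewrite E2 E3 E4 E6 => {fr}.
move=> /(_ isT) F2 /(_ isT) F3 /(_ isT) F4 /(_ isT) F6.
block.
set s3 := foldl _ _ _.
have : [/\ s3.2 = s.2, s3.1 2 = n, s3.1 3 = p, s3.1 4 = k & s3.1 6 = 3 + n * n] /\
   [/\ s3.1 7 = 3 + n * n + p * n, s3.1 5 = 4 ^ p, s3.1 8 = (2 ^ p).-1 & s3.1 16 = p].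
  by rewrite /s3; exec_simpl; rewrite E12' F3 add0n subn1.
clearbody s3 => -[[M3 G2 G3 G4 G6] [G7 G5 G8 G16]].
apply: (wp_weaken (T := p * 6 + 1)).
- apply: (wp_loop (I := fun m s1 => [/\ s1.2 = s.2 & s1.1 8 + m * 4 ^ p = target p]) (B := 1)).
  + by [].
  + by rewrite M3 G8 G16 addnC.
  + move=> m s4 _ _ fr [E8 H]; apply: wp_do => //; exec_simpl; split=> //.
    rewrite (fr 5) // G5; lia.
  + rewrite G16; lia.
- rewrite /copy /=; lia.
move=> s4 [_ fr [Hm H8]].
rewrite (fr 2) // (fr 3) // (fr 4) // (fr 5) // (fr 6) // (fr 7) //.
by split; split=> //; lia.
Qed.

(** * Vertex weights read off the input *)

Definition vertex_weight (m : nat -> nat) (n p v : nat) : nat :=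
  4 ^ p + \sum_(i < p) (m (3 + n * n + i * n + v) != 0) * 2 ^ i.

Definition weigh : cmd :=
  Do (copy 11 5 ++ [:: IConst 12 1] ++ copy 20 10 ++ copy 17 3) ;;
  loop 17 (Do [:: ILoad 19 20] ;; If 19 (Do [:: IAdd 11 11 12]) ;;
           Do [:: IAdd 12 12 12; IAdd 20 20 2]).

Lemma wp_weigh (s : store) n p v :
  s.1 2 = n -> s.1 3 = p -> s.1 5 = 4 ^ p -> s.1 10 = 3 + n * n + v ->
  wp weigh s (10 + p * 10) (fun s' =>
    s'.2 = s.2 /\ s'.1 11 = vertex_weight s.2 n p v).
Proof.
move=> R2 R3 R5 R10; rewrite /weigh.
block.
set s0 := foldl _ _ _.
have : [/\ s0.2 = s.2, s0.1 2 = n, s0.1 11 = 4 ^ p & s0.1 12 = 1] /\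
    (s0.1 20 = 3 + n * n + v /\ s0.1 17 = p) by rewrite /s0; exec_simpl.
clearbody s0; case=> -[M0 E2 E11 E12] [E20 E17].
apply: (wp_weaken (T := p * 10 + 1)).
- apply: (wp_loop (I := fun m s1 => [/\ s1.2 = s.2, m <= p,
    s1.1 11 = 4 ^ p + \sum_(i < p - m) (s.2 (3 + n * n + i * n + v) != 0) * 2 ^ i,
    s1.1 12 = 2 ^ (p - m) & s1.1 20 = 3 + n * n + (p - m) * n + v]) (B := 5)).
  + by [].
  + by rewrite E17 subnn big_ord0 !addn0; split.
  + move=> m s1 _ _ fr [M mp F11 F12 F20].
    block.
    apply: (@wp_seq 2 2 (fun s3 => [/\ s3.2 = s.2, s3.1 2 = n, s3.1 11 =
        4 ^ p + \sum_(i < p - m) (s.2 (3 + n * n + i * n + v) != 0) * 2 ^ i,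
        s3.1 12 = 2 ^ (p - m.+1) & s3.1 20 = 3 + n * n + (p - m.+1) * n + v])).
    * have -> : p - m = (p - m.+1).+1 by lia.
      rewrite big_ord_recr.
      apply: wp_if; exec_simpl; rewrite M F20 => H.
        by rewrite (fr 2) // E2 F11 F12 H mul0n addn0.
      apply: wp_do => //; exec_simpl; rewrite (fr 2) // E2 F11 F12 F20 H.
      by rewrite mul1n addnA; split.
    * by [].
    move=> s3 [N2 N3 N11 N12 N20]; apply: wp_do => //; exec_simpl.
    rewrite N2 N3 N11 N12 N20 (_ : p - m = (p - m.+1).+1); last by lia.
    rewrite expnS; split=> //; lia.
  + rewrite E17; lia.
- rewrite /copy /=; lia.
by move=> s4 [_ _ [Hm _ H11 _ _]]; rewrite subn0 in H11.
Qed.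

(** Memory is described as [nth 0] of a list. Cells beyond the list are 0, so a write to the first
    free cell is an append. *)
Lemma update_rcons (d : seq nat) a x :
  a = size d -> update (nth 0 d) a x = nth 0 (rcons d x).
Proof.
move=> ->; apply: funext => j; rewrite /update nth_rcons.
by case: (ltngtP j (size d)) => // H; rewrite nth_default // ltnW.
Qed.

(** Only input cells are read, so weights stay the same while the list of cliques grows behind the
    input. *)
Lemma vertex_weight_ext (m m' : nat -> nat) n p v :
  v < n -> (forall a, a < 3 + n * n + p * n -> m a = m' a) ->
  vertex_weight m n p v = vertex_weight m' n p v.
Proof.
move=> vn E; congr addn; apply: eq_bigr => i _; rewrite E //.
have : i.+1 * n <= p * n by rewrite leq_mul2r ltn_ord orbT.
rewrite mulSn; lia.
Qed.

(** * Enumeration of the cliques in memory *)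

Definition non_neighbours (m : nat -> nat) (n : nat) (C : seq nat) (u : nat) : nat :=
  \sum_(x <- C) (1 - m (3 + x * n + u)).

(* Record of a clique C: its weight, then for every u the number of vertices of
   C that are not adjacent to u. *)
Definition row (m : nat -> nat) (n p : nat) (C : seq nat) : seq nat :=
  \sum_(x <- C) vertex_weight m n p x :: mkseq (non_neighbours m n C) n.

Lemma size_row m n p C : size (row m n p C) = n.+1.
Proof. by rewrite /row /= size_mkseq. Qed.

(** On a 0/1 adjacency matrix the condition says that [v] is adjacent to all of [C]. New cliques go
    behind the old ones, which therefore keep their addresses. *)
Definition grow (m : nat -> nat) (n v : nat) (L : seq (seq nat)) : seq (seq nat) :=
  L ++ [seq v :: C | C <- L & non_neighbours m n C v == 0].

Fixpoint cliques (m : nat -> nat) (n j : nat) : seq (seq nat) :=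
  if j is j'.+1 then grow m n j' (cliques m n j') else [:: [::]].

Definition contents (inp : seq nat) (n p : nat) (L : seq (seq nat)) : seq nat :=
  inp ++ flatten [seq row (nth 0 inp) n p C | C <- L].

Lemma contents_cat inp n p L L' :
  contents inp n p (L ++ L') = contents inp n p L ++ flatten [seq row (nth 0 inp) n p C | C <- L'].
Proof. by rewrite /contents map_cat flatten_cat catA. Qed.

Lemma contents_rcons inp n p L C :
  contents inp n p (rcons L C) = contents inp n p L ++ row (nth 0 inp) n p C.
Proof. by rewrite /contents map_rcons flatten_rcons catA. Qed.

Lemma flatten_cons (T : Type) (x : seq T) s : flatten (x :: s) = x ++ flatten s.
Proof. by []. Qed.

Lemma size_contents inp n p L : size (contents inp n p L) = size inp + size L * n.+1.
Proof.
rewrite /contents size_cat; congr addn.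
by elim: L => // C L IHL; rewrite map_cons flatten_cons size_cat IHL size_row mulSn.
Qed.

(** The suffix [c] stands for records appended later, so old records can be read while new ones are
    being written. *)
Lemma nth_contents inp n p L i j c : i < size L -> j <= n ->
  nth 0 (contents inp n p L ++ c) (size inp + i * n.+1 + j)
  = nth 0 (row (nth 0 inp) n p (nth [::] L i)) j.
Proof.
move=> iL jn; rewrite /contents -catA -addnA nth_cat ltnNge leq_addr /= addKn.
elim: L i iL => // C L IHL [|i] iL; rewrite map_cons flatten_cons -catA nth_cat size_row.
  by rewrite mul0n add0n ltnS jn.
by rewrite mulSn -addnA ltnNge leq_addr /= addKn IHL.
Qed.

(** Register 20 is advanced before it is read, which skips the weight at the head of the old
    record. *)
Definition copy_row : cmd :=
  Do (copy 20 21 ++ copy 23 9 ++ copy 18 2) ;;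
  loop 18 (Do [:: IConst 19 1; IAdd 20 20 19; ILoad 24 20; ILoad 25 23; ISub 26 19 25;
                  IAdd 24 24 26; IStore 13 24; IAdd 13 13 19; IAdd 23 23 19]).

(** The two size conditions keep all reads inside [c], so they are unaffected by the entries being
    appended. *)
Lemma wp_copy_row (s : store) (c : seq nat) lp ar n :
  s.1 21 = lp -> s.1 9 = ar -> s.1 2 = n -> s.1 13 = size c -> s.2 = nth 0 c ->
  lp + n < size c -> ar + n <= size c ->
  wp copy_row s (10 + n * 15) (fun s' => s'.1 13 = size c + n /\
    s'.2 = nth 0 (c ++ mkseq (fun u => nth 0 c (lp.+1 + u) + (1 - nth 0 c (ar + u))) n)).
Proof.
move=> R21 R9 R2 R13 M Hlp Har; rewrite /copy_row.
block.
set s0 := foldl _ _ _.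
have : [/\ s0.2 = nth 0 c, s0.1 20 = lp & s0.1 23 = ar] /\
    (s0.1 13 = size c /\ s0.1 18 = n) by rewrite /s0; exec_simpl.
clearbody s0; case=> -[M0 E20 E23] [E13 E18].
set F := (X in mkseq X n).
apply: (wp_weaken (T := n * 14 + 1)).
- apply: (wp_loop (I := fun m s1 => [/\ m <= n,
     s1.2 = nth 0 (c ++ mkseq F (n - m)), s1.1 13 = size c + (n - m),
     s1.1 20 = lp + (n - m) & s1.1 23 = ar + (n - m)]) (B := 9)).
  + by [].
  + by rewrite E18 subnn cats0 !addn0; split.
  + move=> m s1 _ _ fr [mn M1 F13 F20 F23]; apply: wp_do => //; exec_simpl.
    rewrite M1 F13 F20 F23 update_rcons; last by rewrite size_cat size_mkseq.
    rewrite (_ : n - m = (n - m.+1).+1); last by lia.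
    rewrite mkseqS -rcons_cat {3}/F !nth_cat.
    have -> : lp + (n - m.+1) + 1 < size c by lia.
    have -> : ar + (n - m.+1) < size c by lia.
    split; [lia| |lia|lia|lia].
    by congr (nth 0 (rcons _ (nth 0 c _ + _))); lia.
  + rewrite E18; lia.
- rewrite /=; lia.
by move=> s4 [_ _ [_ H2 H13 _ _]]; rewrite subn0 in H2 H13.
Qed.

(** The number of rounds is the old length of the list, so new records are not scanned again. Entry
    v of a record has offset v + 1, after the weight; register 26 is nonzero exactly if that entry
    is 0. *)
Definition extend : cmd :=
  Do (copy 21 7 ++ copy 17 14) ;;
  loop 17 (Do [:: IAdd 28 21 22; ILoad 24 28; IConst 19 1; ISub 26 19 24] ;;
    If 26 (Do [:: ILoad 24 21; IAdd 24 24 11; IStore 13 24; IConst 19 1;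
                  IAdd 13 13 19; IAdd 14 14 19] ;; copy_row) ;;
    Do [:: IAdd 21 21 15]).

Lemma row_cons m n p v C :
  row m n p (v :: C) = vertex_weight m n p v + \sum_(x <- C) vertex_weight m n p x
    :: mkseq (fun u => non_neighbours m n C u + (1 - m (3 + v * n + u))) n.
Proof.
rewrite /row big_cons; congr cons.
by apply: eq_mkseq => u; rewrite /non_neighbours big_cons addnC.
Qed.

Lemma wp_extend (s : store) inp n p v L :
  v < n -> size inp = 3 + n * n + p * n ->
  s.1 2 = n -> s.1 7 = size inp -> s.1 9 = 3 + v * n ->
  s.1 11 = vertex_weight (nth 0 inp) n p v -> s.1 13 = size (contents inp n p L) ->
  s.1 14 = size L -> s.1 15 = n.+1 -> s.1 22 = v.+1 -> s.2 = nth 0 (contents inp n p L) ->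
  wp extend s (10 + size L * (40 + n * 15)) (fun s' =>
    let L' := grow (nth 0 inp) n v L in
    [/\ s'.1 13 = size (contents inp n p L'), s'.1 14 = size L' &
        s'.2 = nth 0 (contents inp n p L')]).
Proof.
move=> vn Hinp R2 R7 R9 R11 R13 R14 R15 R22 M; rewrite /extend.
block.
set s0 := foldl _ _ _.
set mm := nth 0 inp in R11 *.
(* The cliques created from the first [i] old ones; after [i] rounds the list in memory is
   [L ++ X i]. *)
pose X i := [seq v :: C | C <- take i L & non_neighbours mm n C v == 0].
have : [/\ s0.2 = nth 0 (contents inp n p L), s0.1 2 = n, s0.1 9 = 3 + v * n,
    s0.1 11 = vertex_weight mm n p v & s0.1 15 = n.+1] /\
   [/\ s0.1 13 = size (contents inp n p L), s0.1 14 = size L, s0.1 21 = size inp,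
    s0.1 22 = v.+1 & s0.1 17 = size L] by rewrite /s0; exec_simpl.
clearbody s0; case=> -[M0 E2 E9 E11 E15] [E13 E14 E21 E22 E17].
apply: (wp_weaken (T := size L * (39 + n * 15) + 1)).
- apply: (wp_loop (I := fun m s1 => [/\ m <= size L,
     s1.2 = nth 0 (contents inp n p (L ++ X (size L - m))),
     s1.1 13 = size (contents inp n p (L ++ X (size L - m))),
     s1.1 14 = size (L ++ X (size L - m)) &
     s1.1 21 = size inp + (size L - m) * n.+1]) (B := 25 + n * 15)).
  + by [].
  + by rewrite E17 subnn /X take0 cats0 addn0; split.
  + move=> m s1 _ _ fr [mL M1 F13 F14 F21].
    set i := size L - m.+1 in M1 F13 F14 F21 *.
    have iL : i < size L by lia.
    have -> : size L - m = i.+1 by lia.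
    set C := nth [::] L i.
    have EX : X i.+1 = if non_neighbours mm n C v == 0 then rcons (X i) (v :: C) else X i.
      by rewrite /X (take_nth [::]) // filter_rcons -/C; case: ifP; rewrite ?map_rcons.
    have rd j : j <= n -> s1.2 (size inp + i * n.+1 + j) = nth 0 (row mm n p C) j.
      by move=> jn; rewrite M1 contents_cat nth_contents.
    block; exec_simpl.
    apply: (@wp_seq (20 + n * 15) 1 (fun s3 => [/\
      s3.2 = nth 0 (contents inp n p (L ++ X i.+1)),
      s3.1 13 = size (contents inp n p (L ++ X i.+1)),
      s3.1 14 = size (L ++ X i.+1), s3.1 15 = n.+1 &
      s3.1 21 = size inp + i * n.+1])).
    * apply: (wp_weaken (T := (19 + n * 15).+1)); [|lia|by move=> ?; exact].
      apply: wp_if; exec_simpl; rewrite (fr 22) // E22 F21 rd // /row /= nth_mkseq // => H.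
        have -> : X i.+1 = X i by rewrite EX; case: eqP H => // ->.
        by rewrite (fr 15) // E15.
      have {}EX : X i.+1 = rcons (X i) (v :: C).
        by rewrite EX; case: eqP H => //; case: (non_neighbours _ _ _ _).
      block.
      set s2 := foldl _ _ _.
      set c := contents inp n p (L ++ X i) in M1 F13.
      set w := vertex_weight mm n p v + \sum_(x <- C) vertex_weight mm n p x.
      have : [/\ s2.2 = nth 0 (rcons c w), s2.1 2 = n, s2.1 9 = 3 + v * n &
         s2.1 13 = size (rcons c w)] /\
         [/\ s2.1 14 = (size (L ++ X i)).+1, s2.1 15 = n.+1 & s2.1 21 = size inp + i * n.+1].
        rewrite /s2; exec_simpl; rewrite F13 F14 F21 (fr 2) // (fr 9) // (fr 11) // (fr 15) //.
        rewrite E2 E9 E11 E15 -[_ + i * n.+1]addn0 rd // /row /= addn1 size_rcons addn1.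
        by rewrite M1 update_rcons // [_ + vertex_weight _ _ _ _]addnC.
      clearbody s2; case=> -[G G2 G9 G13] [G14 G15 G21].
      have sc : size c = size inp + (size L + size (X i)) * n.+1.
        by rewrite /c size_contents size_cat.
      have iL1 : i.+1 * n.+1 <= size L * n.+1 by rewrite leq_mul2r iL orbT.
      have vn1 : v.+1 * n <= n * n by rewrite leq_mul2r vn orbT.
      rewrite mulSn in iL1; rewrite mulSn in vn1.
      have H1 : size inp + i * n.+1 + n < size (rcons c w).
        by rewrite size_rcons sc mulnDl; lia.
      have H2 : 3 + v * n + n <= size (rcons c w) by rewrite size_rcons sc Hinp; lia.
      apply: wp_weaken (wp_frame (wp_copy_row G21 G9 G2 G13 G H1 H2)) _ _; first by rewrite /=; lia.
      move=> s3 [fr3 [K13 K]].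
      have Ec : contents inp n p (L ++ X i.+1) = rcons c w ++
         mkseq (fun u => nth 0 (rcons c w) ((size inp + i * n.+1).+1 + u)
           + (1 - nth 0 (rcons c w) (3 + v * n + u))) n.
        rewrite EX -rcons_cat contents_rcons -/c row_cons -/w -cat_rcons.
        congr cat; apply/eq_in_map => u; rewrite mem_iota add0n => /andP[_ un].
        rewrite -cats1 [_.+1 + u]addSnnS.
        rewrite /c contents_cat -catA nth_contents // /row /= nth_mkseq //.
        congr (_ + (1 - _)); rewrite /contents -!catA nth_cat Hinp ifT //; lia.
      rewrite K13 K Ec !(fr3 14, fr3 15, fr3 21) // G14 G15 G21; split=> //.
      * by rewrite size_cat size_mkseq.
      * by rewrite EX !size_cat size_rcons addnS.
    * by rewrite /=; lia.
    move=> s3 [K K13 K14 K15 K21]; apply: wp_do => //; exec_simpl.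
    rewrite K K13 K14 K15 K21; split=> //; lia.
  + rewrite E17; lia.
- rewrite /=; lia.
by move=> s4 [_ _ [_ H H13 H14 _]]; rewrite /X subn0 take_size in H H13 H14.
Qed.

Definition enumerate : cmd :=
  Do ([:: IConst 9 3] ++ copy 10 6 ++
      [:: IConst 19 1; IAdd 15 2 19; IAdd 13 7 15; IConst 14 1; IConst 22 1] ++ copy 16 2) ;;
  loop 16 (weigh ;; extend ;;
    Do [:: IAdd 9 9 2; IConst 19 1; IAdd 10 10 19; IAdd 22 22 19]).

(** Allows the cost of every round of the enumeration to be bounded by the final length of the
    list. *)
Lemma size_cliques_mono m n j j' : j <= j' -> size (cliques m n j) <= size (cliques m n j').
Proof.
move=> /subnKC <-; elim: (j' - j) => [|d IHd]; first by rewrite addn0.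
by rewrite addnS /= size_cat; apply: leq_trans IHd (leq_addr _ _).
Qed.

Lemma wp_enumerate (s : store) inp n p :
  size inp = 3 + n * n + p * n ->
  s.1 2 = n -> s.1 3 = p -> s.1 5 = 4 ^ p -> s.1 6 = 3 + n * n -> s.1 7 = size inp ->
  s.2 = nth 0 inp ->
  wp enumerate s (20 + n * (40 + p * 10 + size (cliques (nth 0 inp) n n) * (40 + n * 15)))
    (fun s' => let L := cliques (nth 0 inp) n n in
      [/\ s'.1 13 = size (contents inp n p L), s'.1 14 = size L, s'.1 15 = n.+1 &
          s'.2 = nth 0 (contents inp n p L)]).
Proof.
move=> Hinp R2 R3 R5 R6 R7 M; rewrite /enumerate.
set mm := nth 0 inp.
block.
set s0 := foldl _ _ _.
have : [/\ s0.2 = nth 0 inp, s0.1 2 = n, s0.1 3 = p & s0.1 5 = 4 ^ p] /\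
   [/\ s0.1 9 = 3, s0.1 10 = 3 + n * n, s0.1 7 = size inp, s0.1 15 = n.+1 &
   [/\ s0.1 13 = size inp + n.+1, s0.1 14 = 1, s0.1 22 = 1 & s0.1 16 = n]].
  by rewrite /s0; exec_simpl; rewrite R2 R7 addn1.
clearbody s0; case=> -[M0 E2 E3 E5] [E9 E10 E7 E15 [E13 E14 E22 E16]].
set N := size (cliques mm n n).
apply: (wp_weaken (T := n * (38 + p * 10 + N * (40 + n * 15)) + 1)).
- apply: (wp_loop (I := fun m s1 => let L := cliques mm n (n - m) in [/\ m <= n,
     s1.2 = nth 0 (contents inp n p L), s1.1 13 = size (contents inp n p L),
     s1.1 14 = size L &
     [/\ s1.1 9 = 3 + (n - m) * n, s1.1 10 = 3 + n * n + (n - m) & s1.1 22 = (n - m).+1]])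
     (B := 30 + p * 10 + N * (40 + n * 15))).
  + by [].
  + rewrite E16 subnn; split=> //.
    (* The record of the empty clique consists of zeros, as does untouched memory, so the first
       record need not be written. *)
    * rewrite M0 /contents /= cats0; apply: funext => a; rewrite nth_cat; case: ltnP => // ia.
      rewrite (nth_default _ ia) /row big_nil /non_neighbours.
      case: (a - size inp) => //= b; case: (ltnP b n) => bn.
        by rewrite nth_mkseq // big_nil.
      by rewrite nth_default // size_mkseq.
    * by rewrite size_contents /= mul1n.
    * by rewrite !addn0; split.
  + move=> m s1 _ _ fr [mn M1 F13 F14 [F9 F10 F22]].
    set v := n - m.+1 in M1 F13 F14 F9 F10 F22 *.
    have vn : v < n by lia.
    have -> : n - m = v.+1 by lia.
    have E : vertex_weight s1.2 n p v = vertex_weight mm n p v.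
      by apply: vertex_weight_ext => // a aI; rewrite M1 nth_cat Hinp aI.
    have G2 : s1.1 2 = n by rewrite (fr 2).
    have G3 : s1.1 3 = p by rewrite (fr 3).
    have G5 : s1.1 5 = 4 ^ p by rewrite (fr 5).
    have G7 : s1.1 7 = size inp by rewrite (fr 7).
    have G15 : s1.1 15 = n.+1 by rewrite (fr 15).
    apply: (wp_seq (wp_frame (wp_weigh G2 G3 G5 F10)) (T2 := 20 + N * (40 + n * 15))).
      by lia.
    move=> s2 [fr2 []]; rewrite E M1 => M2 K11.
    have LN : size (cliques mm n v) <= N by apply: size_cliques_mono; exact: ltnW.
    have [K2 K7 K9 K13] : [/\ s2.1 2 = n, s2.1 7 = size inp, s2.1 9 = 3 + v * n &
        s2.1 13 = size (contents inp n p (cliques mm n v))] by rewrite !fr2.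
    have [K10 K14 K15 K22] : [/\ s2.1 10 = 3 + n * n + v, s2.1 14 = size (cliques mm n v),
        s2.1 15 = n.+1 & s2.1 22 = v.+1] by rewrite !fr2.
    apply: (wp_seq (wp_frame (wp_extend vn Hinp K2 K7 K9 K11 K13 K14 K15 K22 M2)) (T2 := 4)).
      have := leq_mul LN (leqnn (40 + n * 15)); lia.
    move=> s3 [fr3 [J13 J14 J]]; apply: wp_do => //; exec_simpl.
    rewrite J13 J14 J !fr3 // K2 K9 K10 K22; split=> //; first exact: ltnW.
    by split; lia.
  + rewrite E16; lia.
- rewrite /copy /=; lia.
move=> s4 [_ fr [_ H H13 H14 _]]; rewrite subn0 in H H13 H14.
by rewrite (fr 15).
Qed.

(** * The knapsack table and the whole program *)

Definition relax (v r : nat) (R : nat -> nat) (w : nat) : nat -> nat :=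
  update R (v + w) (maxn (R (v + w)) r).

(* For j >= x, entry x of the j-th table is k + 1 minus the least number of
   weights with sum x, and 0 if no k of them suffice. *)
Fixpoint knapsack (k : nat) (ws : seq nat) (j : nat) : nat -> nat :=
  if j is v.+1 then
    let R := knapsack k ws v in foldl (relax v (R v).-1) R ws
  else update (fun _ => 0) 0 k.+1.

(** The table starts right behind the list, in cells that are still 0. The maximum is computed as a
    + (b - a) with truncated subtraction, and the final 1 - (1 - a) turns an entry into a truth
    value. *)
Definition fill : cmd :=
  Do (copy 27 13 ++ [:: IConst 19 1; IAdd 24 4 19; IStore 27 24] ++ copy 16 8) ;;
  loop 16 (Do ([:: ILoad 23 27; IConst 19 1; ISub 23 23 19] ++ copy 21 7 ++ copy 17 14) ;;
    loop 17 (Do [:: ILoad 24 21; IAdd 28 27 24; ILoad 25 28; ISub 26 23 25; IAdd 25 25 26;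
                    IStore 28 25; IAdd 21 21 15]) ;;
    Do [:: IConst 19 1; IAdd 27 27 19]) ;;
  Do [:: ILoad 24 27; IConst 19 1; ISub 24 19 24; ISub 0 19 24].

Lemma wp_fill (s : store) k b n e t ws :
  s.1 4 = k -> s.1 7 = b -> s.1 8 = t -> s.1 13 = e -> s.1 14 = size ws -> s.1 15 = n.+1 ->
  (forall i, i < size ws -> s.2 (b + i * n.+1) = nth 0 ws i) -> b + size ws * n.+1 <= e ->
  (forall x, s.2 (e + x) = 0) ->
  wp fill s (20 + t * (30 + size ws * 12)) (fun s' => s'.1 0 = (0 < knapsack k ws t t)).
Proof.
move=> R4 R7 R8 R13 R14 R15 Hws He Hz; rewrite /fill.
block.
set s0 := foldl _ _ _.
have : [/\ s0.2 = update s.2 e k.+1, s0.1 7 = b, s0.1 14 = size ws & s0.1 15 = n.+1] /\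
   [/\ s0.1 27 = e & s0.1 16 = t].
  by rewrite /s0; exec_simpl; rewrite R4 R13 add0n addn1.
clearbody s0; case=> -[M0 E7 E14 E15] [E27 E16].
(* The table is written only at addresses from [e] on, so the weights can be read from every later
   memory. *)
have Hws' (m : nat -> nat) i : (forall a, a < e -> m a = s.2 a) -> i < size ws ->
    m (b + i * n.+1) = nth 0 ws i.
  move=> Em iw; rewrite Em ?Hws //.
  have : i.+1 * n.+1 <= size ws * n.+1 by rewrite leq_mul2r iw orbT.
  by rewrite mulSn; lia.
apply: (@wp_seq (t * (27 + size ws * 12) + 1) 4 (fun s1 => s1.1 27 = e + t /\
   forall x, s1.2 (e + x) = knapsack k ws t x)); last first.
- move=> s1 [E M]; apply: wp_do => //; exec_simpl; rewrite E M.
  by case: (knapsack k ws t t) => [|a] //=; rewrite subSS sub0n.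
- rewrite /=; lia.
apply: (wp_weaken (T := t * (27 + size ws * 12) + 1)); [apply: (wp_loop
    (I := fun m s1 => [/\ s1.1 27 = e + (t - m), m <= t,
   forall a, a < e -> s1.2 a = s.2 a & forall x, s1.2 (e + x) = knapsack k ws (t - m) x])
   (B := 22 + size ws * 12))|by []|move=> s1 [_ _ [E _ _ H]]; rewrite subn0 in E H; by split].
- by [].
- rewrite E16 subnn addn0 M0; split=> //= [a ae|x]; rewrite /update; first by rewrite ltn_eqF.
  by rewrite -{2}[e]addn0 eqn_add2l Hz.
- move=> m s1 _ _ fr [F27 mt Flow Fhi].
  set v := t - m.+1 in F27 Fhi *.
  have -> : t - m = v.+1 by lia.
  block.
  set s2 := foldl _ _ _.
  set r := (knapsack k ws v v).-1.
  have : [/\ s2.2 = s1.2, s2.1 27 = e + v, s2.1 21 = b, s2.1 17 = size ws & s2.1 15 = n.+1] /\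
      s2.1 23 = r.
    rewrite /s2; exec_simpl; rewrite F27 Fhi (fr 7) // (fr 14) // (fr 15) // E7 E14 E15.
    by rewrite subn1.
  clearbody s2; case=> -[M2 G27 G21 G17 G15] G23.
  apply: (@wp_seq (size ws * 12 + 1) 3 (fun s3 => [/\ s3.1 27 = e + v,
     forall a, a < e -> s3.2 a = s.2 a & forall x, s3.2 (e + x) = knapsack k ws v.+1 x])).
  + apply: (wp_weaken (T := size ws * 12 + 1)); [apply: (wp_loop (I := fun m s3 =>
      [/\ m <= size ws, s3.1 21 = b + (size ws - m) * n.+1, forall a, a < e -> s3.2 a = s.2 a &
       forall x, s3.2 (e + x) = foldl (relax v r) (knapsack k ws v) (take (size ws - m) ws) x])
      (B := 7))|by []|]; last 1 first.
    * move=> s3 [_ fr3 [_ _ H1 H2]]; rewrite (fr3 27) // G27; split=> // x.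
      by rewrite H2 subn0 take_size.
    * by [].
    * by rewrite G17 subnn take0 /= M2 addn0; split.
    * move=> m' s3 _ _ fr3 [mw K21 Klow Khi]; apply: wp_do => //; exec_simpl.
      set i := size ws - m'.+1 in K21 Khi *.
      have iw : i < size ws by lia.
      have -> : size ws - m' = i.+1 by lia.
      rewrite (fr3 15) // (fr3 23) // (fr3 27) // G15 G23 G27 K21 Hws' //.
      rewrite (take_nth 0) // -cats1 foldl_cat /=.
      rewrite -[e + v + _]addnA Khi; set R := foldl _ _ _.
      split=> [|||x].
      - exact: ltnW.
      - by rewrite mulSn; lia.
      - by move=> a ae; rewrite /update ltn_eqF ?Klow //; lia.
      - rewrite /relax /update eqn_add2l; case: eqP => // _.
        by rewrite maxnE.
    * rewrite G17; lia.
  + rewrite /copy /=; lia.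
  move=> s3 [K27 Klow Khi]; apply: wp_do => //; exec_simpl.
  rewrite K27; split=> //; [lia|exact: ltnW].
- rewrite E16; lia.
Qed.

Definition scp_program : cmd := setup ;; enumerate ;; fill.

Definition scp_cost (n p N : nat) : nat :=
  (40 + n * 6 + p * 20) + (20 + n * (40 + p * 10 + N * (40 + n * 15)))
  + (20 + target p * (30 + N * 12)).

Lemma wp_scp_program inp n p k :
  size inp = 3 + n * n + p * n -> nth 0 inp 0 = n -> nth 0 inp 1 = p -> nth 0 inp 2 = k ->
  let L := cliques (nth 0 inp) n n in
  let ws := [seq \sum_(x <- C) vertex_weight (nth 0 inp) n p x | C <- L] in
  wp scp_program (fun _ => 0, nth 0 inp) (scp_cost n p (size L))
    (fun s => s.1 0 = (0 < knapsack k ws (target p) (target p))).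
Proof.
move=> Hinp H0 H1 H2 L ws; rewrite /scp_program /scp_cost -addnA.
apply: (wp_seq (@wp_setup (_, nth 0 inp) n p k H0 H1 H2)); first exact: leqnn.
move=> s1 /= [[M E2 E3 E4] [E5 E6 E7 E8]].
rewrite -Hinp in E7.
apply: (wp_seq (wp_frame (wp_enumerate Hinp E2 E3 E5 E6 E7 M))); first exact: leqnn.
move=> s2 [fr [F13 F14 F15 FM]].
have sw : size ws = size L by rewrite size_map.
rewrite -sw; apply: (wp_fill (b := size inp) (e := size (contents inp n p L)) (n := n)).
- by rewrite (fr 4).
- by rewrite (fr 7).
- by rewrite (fr 8).
- by [].
- by rewrite sw.
- by [].
- move=> i; rewrite sw => iL; rewrite FM -[_ + i * n.+1]addn0 -[contents _ _ _ _]cats0.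
  by rewrite nth_contents // (nth_map [::]).
- by rewrite size_contents sw.
- by move=> x; rewrite FM nth_default // leq_addr.
Qed.

(** * Correctness of the knapsack table *)

Lemma relax_ge v r R w x : R x <= relax v r R w x.
Proof. by rewrite /relax /update; case: eqP => // ->; apply: leq_maxl. Qed.

Lemma foldl_relax_ge v r ws R x : R x <= foldl (relax v r) R ws x.
Proof.
by elim: ws R => //= w ws IHws R; apply: leq_trans (IHws _); apply: relax_ge.
Qed.

Lemma foldl_relax_reach v r ws R w : w \in ws -> r <= foldl (relax v r) R ws (v + w).
Proof.
elim: ws R => //= w' ws IHws R; rewrite inE => /orP[/eqP->|/IHws//].
apply: leq_trans (foldl_relax_ge _ _ _ _ _).
by rewrite /relax /update eqxx leq_maxr.
Qed.

(** A positive entry is always witnessed by a list of weights: a relaxation that raises entry v + w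
    prepends [w] to the witness of v, using up one of the allowed weights. *)
Lemma knapsack_sound k ws v x : 0 < knapsack k ws v x ->
  exists s : seq nat, [/\ {subset s <= ws}, sumn s = x & size s + knapsack k ws v x <= k.+1].
Proof.
elim: v x => [|v IHv] x /=.
  by rewrite /update; case: eqP => // -> _; exists [::].
set R := knapsack k ws v in IHv *; set r := (R v).-1.
have Hv : 0 < r -> exists s : seq nat, [/\ {subset s <= ws}, sumn s = v & size s + r.+1 <= k.+1].
  rewrite /r => r0; have [|s [H1 H2 H3]] := IHv v; first by case: (R v) r0.
  by exists s; split=> //; rewrite prednK //; case: (R v) r0.
clearbody r R.
(* The inner loop runs through a list [ws'] that shrinks in the induction, while witnesses may use
   all of [ws]. *)
suff H ws' : {subset ws' <= ws} -> 0 < foldl (relax v r) R ws' x -> exists s,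
    [/\ {subset s <= ws}, sumn s = x & size s + foldl (relax v r) R ws' x <= k.+1] by exact: H.
elim: ws' R IHv x => [|w ws' IHws] R HR x Hws /=; first exact: HR.
apply: IHws; last by move=> w' w'ws; apply: Hws; rewrite inE w'ws orbT.
move=> y; rewrite /relax /update; case: eqP => [->|_]; last exact: HR.
rewrite /maxn; case: (ltnP (R (v + w)) r) => [_ r0|_]; last exact: HR.
have [s [H1 H2 H3]] := Hv r0; exists (w :: s); split=> /=.
- by move=> z; rewrite inE => /orP[/eqP->|/H1//]; apply: Hws; rewrite inE eqxx.
- by rewrite H2 addnC.
- by rewrite addSnnS.
Qed.

(** Once cell [sumn s] has been processed, the entry of [w :: s] is at least k + 1 minus its length.
    Positivity makes the sum of a proper tail strictly smaller, so its cell is processed earlier. *)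
Lemma knapsack_complete k ws v :
  k < knapsack k ws v 0 /\
  forall (w : nat) (s : seq nat), {subset w :: s <= ws} -> all (ltn 0) (w :: s) -> sumn s < v ->
    k - size s <= knapsack k ws v (sumn (w :: s)).
Proof.
elim: v => [|v [IH0 IHv]]; first by [].
split; first by apply: leq_trans IH0 (foldl_relax_ge _ _ _ _ _).
move=> w s sub pos; rewrite ltnS leq_eqVlt => /orP[/eqP sv|sv]; last first.
  by apply: leq_trans (IHv w s sub pos sv) (foldl_relax_ge _ _ _ _ _).
rewrite [sumn _]/= sv addnC [knapsack _ _ _]/=.
apply: leq_trans (foldl_relax_reach _ _ _ _); last by apply: sub; rewrite inE eqxx.
suff : k.+1 - size s <= knapsack k ws v v by lia.
case: s sub pos sv => [|w' s] sub pos sv; first by rewrite -sv.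
rewrite -{2}sv; apply: IHv.
- by move=> x xs; apply: sub; rewrite inE xs orbT.
- by case/andP: pos.
- by move: pos sv => /= /and3P[_ + _] => w0 <-; lia.
Qed.

Lemma knapsackP k ws t :
  reflect (exists s : seq nat, [/\ {subset s <= ws}, sumn s = t & size s <= k])
    (0 < knapsack k ws t t).
Proof.
apply: (iffP idP) => [H|[s [sub st sk]]].
  by have [s [H1 H2 H3]] := knapsack_sound H; exists s; split=> //; lia.
(* The list of weights may contain 0, the weight of the empty clique; dropping zeros keeps the sum
   and does not lengthen the list. *)
pose s' := [seq x <- s | 0 < x].
have {st} st : sumn s' = t.
  by rewrite -st /s'; elim: (s) => //= -[|x] l IHl /=; rewrite IHl.
have {sk} sk : size s' <= k by apply: leq_trans sk; rewrite size_filter count_size.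
have {sub} sub : {subset s' <= ws} by move=> x; rewrite mem_filter => /andP[_ /sub].
have pos : all (ltn 0) s' by apply: filter_all.
case: s' st sk sub pos => [<-|w s' st sk sub pos] //.
have [_ /(_ w s' sub pos)] := knapsack_complete k ws t.
rewrite st => H; apply: leq_trans (H _); first by rewrite subn_gt0.
by move: pos st => /= /andP[w0 _]; lia.
Qed.

Lemma sum_pow2 p (a : nat -> nat) :
  \sum_(i < p) a i * 2 ^ i = (2 ^ p).-1 -> \sum_(i < p) a i <= p ->
  forall i, i < p -> a i = 1.
Proof.
(* a 0 is odd; carrying (a 0)./2 to the next digit decreases the digit sum. *)
elim: p a => [|p IHp] a //.
rewrite !big_ord_recl expn0 muln1 expnS => Hs Hc.
have [b Hb] : exists b, a 0 = (b.*2).+1.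
  exists (a 0)./2.
  have : odd (2 * 2 ^ p).-1 by rewrite mul2n -subn1 oddB ?double_gt0 ?expn_gt0 // odd_double.
  rewrite -Hs oddD [X in _ (+) X](_ : _ = false) ?addbF; last first.
    rewrite (eq_bigr (fun i : 'I_p => 2 * (a i.+1 * 2 ^ i))); last first.
      by move=> i _; rewrite lift0 expnS mulnCA.
    by rewrite -big_distrr /= oddM.
  by move=> oa; rewrite -[LHS]odd_double_half oa.
have {}Hs : b + \sum_(i < p) a i.+1 * 2 ^ i = (2 ^ p).-1.
  move: Hs; rewrite (eq_bigr (fun i : 'I_p => 2 * (a i.+1 * 2 ^ i))); last first.
    by move=> i _; rewrite lift0 expnS mulnCA.
  by rewrite -big_distrr /= Hb; have := expn_gt0 2 p; lia.
have {}Hc : b.*2 + \sum_(i < p) a i.+1 <= p by move: Hc; rewrite Hb.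
case: p IHp Hs Hc => [|p] IHp Hs Hc.
  rewrite !big_ord0 expn0 in Hs Hc => -[|//] _; lia.
pose a' i := if i is 0 then a 1 + b else a i.+1.
have Ha' : forall i, i < p.+1 -> a' i = 1.
  apply: IHp; rewrite !big_ord_recl /=.
    by rewrite -Hs big_ord_recl /=; lia.
  move: Hc; rewrite big_ord_recl /= => Hc; rewrite -/(bump 0 _); lia.
(* The digits [a'] are all 1, so b plus the sum of the higher digits of [a] is p + 1. By [Hc] this
   sum plus twice b is at most p + 1 as well. *)
have b0 : b = 0.
  have : \sum_(i < p.+1) a' i = p.+1.
    rewrite (eq_bigr (fun _ => 1)) ?sum1_card ?card_ord // => i _; exact: Ha'.
  move: Hc; rewrite !big_ord_recl /= => Hc.
  lia.
case=> [_|[|i] ip]; first by rewrite Hb b0.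
- by have := Ha' 0 isT; rewrite /= b0 addn0.
- exact: (Ha' i.+1).
Qed.

(** * Instances as knapsack problems *)

Lemma nth_allpairs (S T R : Type) (f : S -> T -> R) s t x0 y0 z0 i j N :
  i < size s -> j < N -> size t = N ->
  nth z0 [seq f x y | x <- s, y <- t] (i * N + j) = f (nth x0 s i) (nth y0 t j).
Proof.
move=> + ltjt sN; rewrite -sN in ltjt *.
elim: s i => //= x s IHs [|i] ltis; rewrite nth_cat size_map.
  by rewrite ltjt (nth_map y0).
by rewrite mulSn -addnA ltnNge leq_addr /= addKn IHs.
Qed.

Lemma size_encode I : size (scp_encode I) = 3 + scp_n I * scp_n I + scp_p I * scp_n I.
Proof. by rewrite /scp_encode !size_cat !size_allpairs size_enum_ord addnA. Qed.

Lemma encode_edge I (x y : 'I_(scp_n I)) :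
  nth 0 (scp_encode I) (3 + x * scp_n I + y) = scp_graph I x y.
Proof.
have xn := ltn_ord x; have yn := ltn_ord y.
have le : x.+1 * scp_n I <= scp_n I * scp_n I by rewrite leq_mul2r xn orbT.
rewrite /scp_encode -addnA nth_cat /= nth_cat size_allpairs size_enum_ord.
rewrite subSS subSS subSS subn0 ifT; last by move: le; rewrite mulSn; lia.
rewrite (@nth_allpairs _ _ _ _ _ _ x y) ?size_enum_ord //.
by rewrite !nth_ord_enum.
Qed.

Lemma encode_part I i (x : 'I_(scp_n I)) : i < scp_p I ->
  nth 0 (scp_encode I) (3 + scp_n I * scp_n I + i * scp_n I + x)
  = (x \in nth set0 (scp_parts I) i).
Proof.
move=> ip; have xn := ltn_ord x.
rewrite /scp_encode -!addnA nth_cat /= !subSS subn0 nth_cat size_allpairs size_enum_ord.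
rewrite ltnNge leq_addr /= addKn.
rewrite (@nth_allpairs _ _ _ _ _ _ set0 x) ?size_enum_ord //.
by rewrite !nth_ord_enum.
Qed.

(** * Cliques and weights of a fixed instance *)

Section Instance.
Context (I : scp_instance).
Let n := scp_n I.
Let p := scp_p I.
Let m := nth 0 (scp_encode I).
Let G := scp_graph I.
Let part i : {set 'I_n} := nth set0 (scp_parts I) i.

Lemma vertex_weightE (v : 'I_n) :
  vertex_weight m n p v = 4 ^ p + \sum_(i < p) (v \in part i) * 2 ^ i.
Proof. by congr addn; apply: eq_bigr => i _; rewrite /m encode_part // eqb0 negbK. Qed.

Definition vertices (C : seq nat) : {set 'I_n} := [set v : 'I_n | val v \in C].

Lemma vertices_cons (v : 'I_n) C : vertices (val v :: C) = v |: vertices C.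
Proof. by apply/setP => x; rewrite !inE. Qed.

Lemma non_neighbours_eq0 (C : seq nat) (v : 'I_n) : all (ltn^~ n) C ->
  (non_neighbours m n C v == 0) = [forall x in vertices C, G x v].
Proof.
move=> /allP Cn; rewrite /non_neighbours sum_nat_seq_eq0; apply/allP/forall_inP => H.
  move=> x; rewrite inE => /H /=; rewrite /m encode_edge; by case: (scp_graph I x v).
move=> x xC; have xn := Cn _ xC.
have := H (Ordinal xn); rewrite inE => /(_ xC) Gxv.
by rewrite /m (encode_edge (Ordinal xn)) [scp_graph I _ _]Gxv.
Qed.

Lemma clique_setU1 (v : 'I_n) (A : {set 'I_n}) :
  v \notin A -> clique G (v |: A) = clique G A && [forall x in A, G x v].
Proof.
move=> vA; apply/forall_inP/andP => [H|[/forall_inP H1 /forall_inP H2] x].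
  split; apply/forall_inP => x xA.
    have /forall_inP Hx := H x (setU1r _ xA); apply/forall_inP => y yA.
    exact: Hx (setU1r _ yA).
  have /forall_inP Hx := H x (setU1r _ xA).
  have /implyP := Hx v (setU11 _ _); apply; by apply: contraNneq vA => <-.
rewrite in_setU1 => /predU1P[->|xA]; apply/forall_inP => y; rewrite in_setU1 => /predU1P[->|yA].
- by rewrite eqxx.
- by apply/implyP => _; rewrite edge_sym; exact: H2.
- by apply/implyP => _; exact: H2.
- by have /forall_inP := H1 x xA; apply.
Qed.

Lemma cliques_sound j C : j <= n -> C \in cliques m n j ->
  [/\ uniq C, all (ltn^~ j) C & clique G (vertices C)].
Proof.
elim: j C => [|j IHj] C jn /=.
  rewrite inE => /eqP->; split=> //; apply/forall_inP => x; by rewrite inE.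
rewrite mem_cat => /orP[/IHj[]|/mapP[D]]; first exact: ltnW.
  by move=> H1 H2 H3; split=> //; apply: sub_all H2 => x /ltnW.
rewrite mem_filter => /andP[HD] /IHj[|H1 H2 H3]; first exact: ltnW.
move=> ->; pose v := Ordinal jn.
have jD : j \notin D by apply/negP => /(allP H2) /=; rewrite ltnn.
split; first by rewrite /= jD.
  by rewrite /= ltnSn; apply: sub_all H2 => x /ltnW.
rewrite (vertices_cons v) clique_setU1 ?inE // H3 /=.
rewrite -non_neighbours_eq0 //; apply: sub_all H2 => x xj; exact: ltn_trans xj jn.
Qed.

(** Subsets of cliques are cliques: a clique containing its largest possible vertex is obtained from
    the clique without it. *)
Lemma cliques_complete j (A : {set 'I_n}) : j <= n ->
  clique G A -> (forall x : 'I_n, x \in A -> x < j) ->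
  exists2 C, C \in cliques m n j & vertices C = A.
Proof.
elim: j A => [|j IHj] A jn cA Aj.
  exists [::] => //; apply/setP => x; rewrite inE; apply/esym/negP => /Aj; by rewrite ltn0.
pose v : 'I_n := Ordinal jn.
have [vA|vA] := boolP (v \in A); last first.
  have [||x xA|C HC EC] := IHj A; [exact: ltnW|exact: cA| |].
    have := Aj x xA; rewrite ltnS leq_eqVlt => /orP[/eqP E|//].
    by case/negP: vA; rewrite (_ : v = x) //; apply: val_inj.
  by exists C => //=; rewrite mem_cat HC.
have := cA; rewrite -(setD1K vA) clique_setU1 ?setD11 // => /andP[cA' vN].
have [||x|C HC EC] := IHj (A :\ v); [exact: ltnW|exact: cA'| |].
  rewrite in_setD1 => /andP[xv /Aj]; rewrite ltnS leq_eqVlt => /orP[/eqP E|//].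
  by case/eqP: xv; apply: val_inj.
exists (val v :: C); last by rewrite vertices_cons EC.
rewrite /= mem_cat map_f ?orbT // mem_filter HC andbT.
rewrite (non_neighbours_eq0 v) ?EC //.
have [_ H _] := cliques_sound (ltnW jn) HC.
by apply: sub_all H => x xj; exact: ltn_trans xj jn.
Qed.

(** Makes the length of the list at most the number of cliques. The sets added for a vertex contain
    it, the earlier ones do not, and removing it recovers the set that was extended. *)
Lemma cliques_uniq j : j <= n -> uniq [seq vertices C | C <- cliques m n j].
Proof.
elim: j => [|j IHj] jn //=.
have U := IHj (ltnW jn).
pose v : 'I_n := Ordinal jn.
have nv C : C \in cliques m n j -> v \notin vertices C.
  move=> /(cliques_sound (ltnW jn)) [_ /allP H _].
  by rewrite inE; apply/negP => /H /=; rewrite ltnn.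
rewrite map_cat cat_uniq U /=; apply/andP; split.
  apply/hasPn => X; rewrite -map_comp => /mapP[C _ ->] /=; apply/mapP => -[D /nv HD E].
  by case/negP: HD; rewrite -E (vertices_cons v) setU11.
rewrite -map_comp.
rewrite map_inj_in_uniq.
  apply: filter_uniq; exact: map_uniq U.
move=> C D; rewrite !mem_filter => /andP[_ HC] /andP[_ HD] /=.
rewrite !(vertices_cons v) => E.
have {}E : vertices C = vertices D.
  by rewrite -(setU1K (nv C HC)) E setU1K // nv.
(* By induction the vertex sets in the old list are distinct, so equal vertex sets have equal
   positions and come from the same list. *)
apply/eqP; rewrite -(nth_index [::] HC) -(nth_index [::] HD).
rewrite nth_uniq ?index_mem // ?(map_uniq U) //.
have := E; rewrite -{1}(nth_index [::] HC) -{1}(nth_index [::] HD).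
rewrite -!(nth_map _ set0) ?index_mem // => /eqP.
by rewrite nth_uniq ?size_map ?index_mem.
Qed.

Definition weight (A : {set 'I_n}) : nat := \sum_(v in A) vertex_weight m n p v.

Lemma sum_vertices (F : nat -> nat) C : uniq C -> all (ltn^~ n) C ->
  \sum_(x <- C) F x = \sum_(v in vertices C) F v.
Proof.
move=> UC /allP Cn; rewrite -big_enum /= -(big_map val xpredT F).
apply: perm_big; apply: uniq_perm => //.
  by rewrite map_inj_uniq ?enum_uniq //; exact: val_inj.
move=> x; apply/idP/mapP => [xC|[v + ->]]; last by rewrite mem_enum inE.
by exists (Ordinal (Cn _ xC)) => //; rewrite mem_enum inE.
Qed.

(** Exchanging the sums over vertices and parts separates the number of vertices from the
    contribution of each part. *)
Lemma weightE (A : {set 'I_n}) :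
  weight A = #|A| * 4 ^ p + \sum_(i < p) #|A :&: part i| * 2 ^ i.
Proof.
rewrite /weight; under eq_bigr => v _ do rewrite vertex_weightE.
rewrite big_split /= sum_nat_const; congr addn; rewrite exchange_big /=.
apply: eq_bigr => i _; rewrite -big_distrl /=; congr muln.
rewrite -sum1_card big_mkcond [RHS]big_mkcond /=; apply: eq_bigr => v _.
by rewrite inE; case: (v \in A); case: (v \in part i).
Qed.

Lemma part_mem i : i < p -> part i \in [set:: scp_parts I].
Proof. by move=> ip; rewrite inE mem_nth. Qed.

Lemma parts_sum (F : {set 'I_n} -> nat) :
  \sum_(B in [set:: scp_parts I]) F B = \sum_(i < p) F (part i).
Proof.
rewrite -(big_mkord xpredT (fun i => F (part i))) -(big_nth set0 xpredT).
rewrite (eq_bigl (mem (scp_parts I))); last by move=> B; rewrite inE.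
by rewrite -big_uniq //; exact: scp_parts_uniq.
Qed.

Lemma card_parts : #|[set:: scp_parts I]| = p.
Proof. by rewrite cardsE; apply/card_uniqP; exact: scp_parts_uniq. Qed.

Lemma sum_card_part (A : {set 'I_n}) : \sum_(i < p) #|A :&: part i| = #|A|.
Proof.
rewrite -(parts_sum (fun B : {set 'I_n} => #|A :&: B|)).
rewrite -[RHS]sum1_card (eq_bigl (fun v => (v \in [set: 'I_n]) && (v \in A))); last first.
  by move=> v; rewrite inE.
rewrite (set_partition_big_cond _ (scp_parts_partition I)); apply: eq_bigr => B _.
by rewrite -sum1_card; apply: eq_bigl => v; rewrite inE andbC.
Qed.

Lemma sum_pow2_all : \sum_(i < p) 1 * 2 ^ i = (2 ^ p).-1.
Proof. by rewrite predn_exp mul1n; apply: eq_bigr => i _; rewrite mul1n. Qed.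

(** Weight is additive over the blocks of the clique partition, so the total is the weight of the
    transversal, which has p vertices, one in each part. *)
Lemma scp_yes_weights : scp_yes I ->
  exists s : seq {set 'I_n}, [/\ all (clique G) s, size s <= scp_k I &
    \sum_(A <- s) weight A = target p].
Proof.
case/existsP => X /andP[trX /existsP[Q /and3P[pQ Qk /forall_inP QG]]].
exists (enum Q); split.
- by apply/allP => A; rewrite mem_enum => /QG.
- by rewrite -cardE.
rewrite big_enum /= -(set_partition_big _ pQ) -/(weight X) weightE.
rewrite (card_transversal trX) card_parts /target -sum_pow2_all; congr addn.
apply: eq_bigr => i _; congr muln.
by have /and3P[_ _ /forall_inP/(_ _ (part_mem (ltn_ord i)))/eqP] := trX.
Qed.

(** If c < p, then S is at most c 2^p, below 4^p, and the total stays below p 4^p. If c > p, the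
    total is at least (p + 1) 4^p, which exceeds the target because 2^p - 1 is below 4^p. *)
Lemma target_count c S : c <= S -> S <= c * 2 ^ p -> c * 4 ^ p + S = target p ->
  c = p /\ S = (2 ^ p).-1.
Proof.
rewrite /target => cS Sc E.
have p2 : p < 2 ^ p by apply: ltn_expl.
have E4 : 4 ^ p = 2 ^ p * 2 ^ p by rewrite -expnMn.
suff cp : c = p by split=> //; move: E; rewrite cp => /addnI.
case: (ltngtP c p) => // cp.
- have : c.+1 * 4 ^ p <= p * 4 ^ p by rewrite leq_mul2r cp orbT.
  have : c * 2 ^ p < 4 ^ p by rewrite E4 ltn_mul2r expn_gt0 (ltn_trans cp).
  rewrite mulSn; lia.
- have : p.+1 * 4 ^ p <= c * 4 ^ p by rewrite leq_mul2r cp orbT.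
  have : 2 ^ p <= 4 ^ p by rewrite E4 leq_pmull ?expn_gt0.
  rewrite mulSn; have := expn_gt0 2 p; lia.
Qed.

(** By [target_count] and [sum_pow2] every part is met exactly once, counted with multiplicity over
    [s]. So the nonempty cliques are disjoint and their union is a transversal. *)
Lemma weights_scp_yes (s : seq {set 'I_n}) :
  all (clique G) s -> size s <= scp_k I -> \sum_(A <- s) weight A = target p -> scp_yes I.
Proof.
move=> /allP sG sk; under eq_bigr => A _ do rewrite weightE.
pose a i := \sum_(A <- s) #|A :&: part i|.
rewrite big_split -big_distrl /= exchange_big /=.
rewrite (eq_bigr (fun i : 'I_p => a i * 2 ^ i)); last by move=> i _; rewrite -big_distrl.
set c := \sum_(A <- s) #|A|.
have ac : \sum_(i < p) a i = c.
  by rewrite exchange_big; apply: eq_bigr => A _; exact: sum_card_part.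
move=> E.
have [] := target_count _ _ E.
- by rewrite -ac; apply: leq_sum => i _; rewrite -{1}[a i]muln1 leq_mul2l expn_gt0 orbT.
- rewrite -ac big_distrl /=; apply: leq_sum => i _.
  by rewrite leq_mul2l leq_exp2l // (ltnW (ltn_ord i)) orbT.
rewrite -ac => cp /sum_pow2 /(_ (eq_leq cp)) a1 {E}.
(* The vertex lies in some part [i], and each clique of [s] containing it contributes to [a i],
   which is 1. *)
have s1 (v : 'I_n) : \sum_(A <- s) (v \in A) <= 1.
  have : v \in cover [set:: scp_parts I] by rewrite (cover_partition (scp_parts_partition I)) inE.
  case/bigcupP => B; rewrite inE => /(nthP set0)[i ip <-] vB.
  rewrite -(a1 i ip); apply: leq_sum => A _.
  by case vA: (v \in A) => //; rewrite card_gt0; apply/set0Pn; exists v; rewrite inE vA.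
have disj A B (v : 'I_n) : A \in s -> B \in s -> v \in A -> v \in B -> A = B.
  move=> As Bs vA vB; apply/eqP/negPn/negP => AB; have := s1 v.
  rewrite (big_rem A) //= vA (big_rem B) /= ?vB //.
  by apply: rem_mem => //; rewrite eq_sym.
(* Blocks of a partition are nonempty, so empty cliques are dropped; this does not increase their
   number. *)
pose Q := [set A in s | A != set0].
pose X := cover Q.
have QX : partition Q X.
  rewrite /partition eqxx /= inE eqxx andbF andbT.
  apply/trivIsetP => A B; rewrite !inE => /andP[As _] /andP[Bs _] AB.
  rewrite -setI_eq0; apply/set0Pn => -[v]; rewrite inE => /andP[vA vB].
  by case/eqP: AB; apply: disj As Bs vA vB.
have memX (v : 'I_n) : (v \in X) = has (fun A : {set 'I_n} => v \in A) s.
  apply/bigcupP/hasP => -[A].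
    by rewrite inE => /andP[As _] vA; exists A.
  by move=> As vA; exists A => //; rewrite inE As; apply/set0Pn; exists v.
apply/existsP; exists X; apply/andP; split.
  rewrite /is_transversal scp_parts_partition subsetT /=; apply/forall_inP => B.
  rewrite inE => /(nthP set0)[i ip EB]; have ai := a1 i ip.
  rewrite eqn_leq; apply/andP; split.
    rewrite -ai -sum1_card.
    apply: (@leq_trans (\sum_(v in X :&: B) \sum_(A <- s) (v \in A :&: B))).
      apply: leq_sum => v; rewrite inE memX => /andP[/hasP[A As vA] vB].
      by rewrite (big_rem A) //= inE vA vB.
    rewrite exchange_big; apply: leq_sum => A _.
    rewrite /part EB -sum1_card [leqLHS]big_mkcond [leqRHS]big_mkcond /=.
    by apply: leq_sum => v _; case: (v \in A :&: B); case: (v \in X :&: B).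
  rewrite card_gt0; apply/set0Pn.
  have : ~~ all (fun A : {set 'I_n} => #|A :&: B| == 0) s.
    apply/negP => /allP H; move: ai; rewrite /a big1_seq // => A /andP[_ As].
    by rewrite /part EB; apply/eqP; exact: H.
  case/allPn => A As; rewrite -lt0n card_gt0 => /set0Pn[v]; rewrite inE => /andP[vA vB].
  by exists v; rewrite inE vB memX andbT; apply/hasP; exists A.
apply/existsP; exists Q; rewrite QX /=; apply/andP; split.
  apply: leq_trans sk; apply: leq_trans (card_size s).
  by apply: subset_leq_card; apply/subsetP => A; rewrite inE => /andP[].
by apply/forall_inP => A; rewrite inE => /andP[/sG].
Qed.

Lemma scp_yes_knapsack :
  let ws := [seq \sum_(x <- C) vertex_weight m n p x | C <- cliques m n n] in
  scp_yes I = (0 < knapsack (scp_k I) ws (target p) (target p)).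
Proof.
move=> ws.
have wC C : C \in cliques m n n ->
    clique G (vertices C) /\ \sum_(x <- C) vertex_weight m n p x = weight (vertices C).
  move=> /(cliques_sound (leqnn _)) [UC Cn cC]; split=> //; exact: sum_vertices.
apply/idP/knapsackP => [/scp_yes_weights[s [/allP sG sk st]]|[s [sub st sk]]].
  exists [seq weight A | A <- s]; split; last by rewrite size_map.
    move=> w /mapP[A /sG cA ->]; apply/mapP.
    have [C HC EC] := cliques_complete (leqnn _) cA (fun x _ => ltn_ord x).
    by exists C => //; have [_ ->] := wC C HC; rewrite EC.
  by rewrite sumnE big_map.
(* Different cliques may have the same weight; any clique with the given weight is chosen for each
   entry of [s]. *)
have [t [tG Et]] : exists t : seq {set 'I_n}, all (clique G) t /\ s = [seq weight A | A <- t].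
  elim: s sub {st sk} => [|w s IHs] sub; first by exists [::].
  have /mapP[C /wC[cC EC] Ew] := sub w (mem_head _ _).
  have [x xs|t [tG ->]] := IHs; first by apply: sub; rewrite inE xs orbT.
  by exists (vertices C :: t); rewrite /= cC tG Ew EC.
apply: (weights_scp_yes tG); first by rewrite -(size_map weight) -Et.
by rewrite -st Et sumnE big_map.
Qed.

End Instance.

(** * Counting cliques in tree decompositions *)

Definition induced (T : finType) (F : sgraph T) (A : {set T}) : rel T :=
  [rel a b | [&& a \in A, b \in A & F a b]].

Lemma induced_sym (T : finType) (F : sgraph T) (A : {set T}) : symmetric (induced F A).
Proof. by move=> x y; rewrite /induced /= (edge_sym F) andbCA. Qed.

Lemma path_induced (T : finType) (F : sgraph T) (A : {set T}) x q :
  path (induced F A) x q -> path F x q /\ all (mem A) q.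
Proof.
by elim: q x => //= y q IHq x /andP[/and3P[_ -> ->] /IHq[-> ->]].
Qed.

(* Otherwise a path from a to b in A and the edges at t would form a cycle. *)
Lemma tree_neighbour_unique (T : finType) (F : sgraph T) (A : {set T}) t a b :
  acyclic F -> {in A &, forall x y, connect (induced F A) x y} ->
  t \notin A -> a \in A -> b \in A -> F t a -> F t b -> a = b.
Proof.
move=> acF cA tA aA bA Fa Fb; apply/eqP/negP => /negP; rewrite eq_sym => ab.
have /connectP[q0 pq0 Eb] := cA a b aA bA.
case/shortenP: pq0 Eb => q pq uq _ Eb.
have {pq} [pq qA] := path_induced pq.
case: q pq uq qA Eb => [|y q] pq uq qA Eb; first by rewrite Eb eqxx in ab.
rewrite Eb /= in Fb; apply: (acF [:: t, a, y & q]) => //.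
rewrite /ucycle /cycle /= -cats1 cat_path /= in pq uq qA Fb *.
case/andP: pq => -> ->; rewrite Fa (edge_sym F) Fb uq !andbT /=.
apply: contra tA; rewrite !inE => /or3P[/eqP->//|/eqP->|tq].
- by case/andP: qA.
- by case/andP: qA => _ /allP /(_ _ tq).
Qed.

(** A rooting of the tree on [A]. The root is its own parent, and [dep] only has to drop towards the
    parent; it need not be the distance from the root. *)
Definition parent_structure (T : finType) (F : sgraph T) (A : {set T})
    (par : T -> T) (dep : T -> nat) : Prop :=
  {in A, forall x, par x = x \/ dep (par x) < dep x} /\
  {in A &, forall x y, F x y -> par x = y \/ par y = x}.

(** The rooted part [A] grows by one node [t] at a time. By acyclicity [t] has a single neighbour in
    [A], which becomes its parent. *)
Lemma tree_parent (T : finType) (F : sgraph T) : is_tree F ->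
  exists par dep, parent_structure F [set: T] par dep.
Proof.
case=> T0 cF acF.
suff H k : k < #|T| -> exists A : {set T}, #|A| = k.+1 /\
    {in A &, forall x y, connect (induced F A) x y} /\
    exists par dep, parent_structure F A par dep /\ {in A, forall x, par x \in A /\ dep x <= k}.
  have [|A [cA [_ [par [dep [H1 _]]]]]] := H #|T|.-1; first by rewrite prednK.
  suff <- : A = [set: T] by exists par, dep.
  by apply/eqP; rewrite eqEcard subsetT cardsT cA prednK /=.
elim: k => [|k IHk] kT.
  have /card_gt0P[r _] := T0.
  exists [set r]; rewrite cards1; split=> //; split.
    by move=> x y /set1P-> /set1P->; exact: connect0.
  exists id, (fun=> 0); split; last by move=> x xr.
  split; first by move=> x _; left.
  by move=> x y /set1P-> /set1P-> _; left.
have [A [cA [coA [par [dep [[P1 P2] P3]]]]]] := IHk (ltnW kT).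
have [/existsP[a /andP[aA /existsP[t /andP[tA Fat]]]]|nex] :=
  boolP [exists a, (a \in A) && [exists t, (t \notin A) && F a t]]; last first.
  (* If no edge leaves [A], connectivity forces [A] to be the whole tree, contrary to its size. *)
  have clA : closed F A.
    move=> x y Fxy; apply/idP/idP => H; apply/negPn/negP => H';
      case/existsP: nex.
      by exists x; rewrite H; apply/existsP; exists y; rewrite H'.
    by exists y; rewrite H; apply/existsP; exists x; rewrite H' (edge_sym F).
  have /card_gt0P[x xA] : 0 < #|A| by rewrite cA.
  suff : A = [set: T] by move=> E; move: kT; rewrite -cA E cardsT ltnn.
  by apply/setP => y; rewrite inE -(closed_connect clA (cF x y)).
have Fta : F t a by rewrite (edge_sym F).
have tx x : x \in A -> (x == t) = false by move=> xA; apply: contraNF tA => /eqP<-.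
have uniq_nb y : y \in A -> F t y -> a = y.
  by move=> yA Fty; exact: tree_neighbour_unique acF coA tA aA yA Fta Fty.
exists (t |: A); split; first by rewrite cardsU1 tA cA.
split.
  have sub : subrel (connect (induced F A)) (connect (induced F (t |: A))).
    apply: connect_sub => x y /and3P[xA yA Fxy]; apply: connect1.
    by rewrite /induced /= !inE xA yA Fxy !orbT.
  have ta : connect (induced F (t |: A)) t a.
    by apply: connect1; rewrite /induced /= !inE eqxx aA orbT.
  have csym := sym_connect_sym (@induced_sym _ F (t |: A)).
  have aT x : x \in t |: A -> connect (induced F (t |: A)) x a.
    by move=> /setU1P[->|xA] //; apply: sub; exact: coA.
  by move=> x y /aT xa /aT ya; apply: connect_trans xa _; rewrite csym.
(* All earlier depths are at most [k], so [k.+1] exceeds the depth of the new parent. *)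
exists (fun x => if x == t then a else par x), (fun x => if x == t then k.+1 else dep x).
split; last first.
  move=> x /setU1P[->|xA]; first by rewrite eqxx !inE aA orbT.
  by have [H1 H2] := P3 x xA; rewrite tx // !inE H1 orbT (leqW H2).
split.
  move=> x /setU1P[->|xA].
    by right; rewrite eqxx tx // ltnS; have [] := P3 a aA.
  by have [H1 _] := P3 x xA; rewrite !tx //; exact: P1.
move=> x y /setU1P[->|xA] /setU1P[->|yA].
- by rewrite (edge_irr F).
- by move=> /(uniq_nb y yA) <-; left; rewrite eqxx.
- by rewrite (edge_sym F) => /(uniq_nb x xA) <-; right; rewrite eqxx.
- by rewrite !tx //; exact: P2.
Qed.

(** * Subtrees of a rooted tree *)

Section Rooted.
Context (T : finType) (F : sgraph T) (par : T -> T) (dep : T -> nat).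
Context (parP : parent_structure F [set: T] par dep).

Definition descends (a s : T) : Prop := exists i, iter i par s = a.

(** Each step to the parent either stays in place or strictly lowers the depth. *)
Lemma descends_dep a s : descends a s -> dep s <= dep a -> s = a.
Proof.
case=> i <-; elim: i s => // i IHi s; rewrite iterSr => H.
have [E|lt] := parP.1 s (in_setT _); first by rewrite E in H *; exact: IHi.
have Hle j x : dep (iter j par x) <= dep x.
  elim: j => //= j IHj; apply: leq_trans IHj.
  by have [->|/ltnW] := parP.1 (iter j par x) (in_setT _).
by have := Hle i (par s); lia.
Qed.

(** Every edge joins a node to its parent, so the only edge leaving the subtree of [a] goes from [a]
    to its parent; [y] is that parent. *)
Lemma path_leaves_subtree (B : {set T}) a s q :
  path (induced F B) s q -> descends a s -> ~ descends a (last s q) ->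
  a \in B /\ exists2 y, y \in B & dep y < dep a.
Proof.
elim: q s => [|x q IHq] s //= /andP[/and3P[sB xB Fsx] pq] Ds ND.
have [Dx|NDx] := pselect (descends a x); first exact: IHq pq Dx ND.
have [Ex|Es] := parP.2 s x (in_setT _) (in_setT _) Fsx; last first.
  by case: NDx; case: Ds => i Ei; exists i.+1; rewrite iterSr Es.
case: Ds => -[|i] Ei; last by case: NDx; exists i; rewrite -Ex -iterSr.
rewrite -Ei /=; split=> //; exists x => //.
have [E|] := parP.1 s (in_setT _); last by rewrite Ex.
by case: NDx; exists 0; rewrite -Ex E -Ei.
Qed.

End Rooted.

(** Every nonempty clique is a subset of [bag (top v)] for one of its vertices [v]; each vertex
    accounts for the subsets of one bag, and the empty set gives the summand 1. *)
Lemma card_cliques_td (V : finType) (G : sgraph V) (T : finType) (F : sgraph T)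
    (bag : T -> {set V}) :
  is_tree_decomposition G F bag ->
  #|[set A | clique G A]| <= #|V| * 2 ^ (td_width bag).+1 + 1.
Proof.
move=> td; have [par [dep parP]] := tree_parent (td_tree td).
pose nodes v := [set t | v \in bag t].
have conn v : {in nodes v &, forall s t, connect (induced F (nodes v)) s t}.
  move=> s t; rewrite !inE => vs vt.
  have := td_connected td vs vt; apply: connect_sub => x y H.
  by apply: connect1; move: H; rewrite /induced /= !inE.
have /choice[top topP] : forall v, exists a, a \in nodes v /\
    {in nodes v, forall t, dep a <= dep t}.
  move=> v; have [t0 vt0] := td_vertex td v.
  have t0n : t0 \in nodes v by rewrite inE.
  by case: (arg_minnP dep t0n) => a an amin; exists a.
(* Otherwise a path within the nodes of [v] would leave the subtree of [top v] and visit a node of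
   smaller depth. *)
have Dtop v s : s \in nodes v -> descends par (top v) s.
  move=> sv; have [tv tmin] := topP v.
  have [//|ND] := pselect (descends par (top v) s).
  have /connectP[q pq Eq] := conn v _ _ tv sv; rewrite Eq in ND.
  have [_ [y yv]] := path_leaves_subtree parP pq (ex_intro _ 0 erefl) ND.
  by rewrite ltnNge tmin.
have key A : clique G A -> A != set0 -> exists2 v, v \in A & A \subset bag (top v).
  (* If v is the vertex of A whose top is deepest, then for u in A the path from
     a common node of u and v to the top of u, within the nodes of u, either
     leaves the subtree below top v, through top v, or ends in top v. *)
  move=> /forall_inP cA /set0Pn[v0 v0A].
  case: (@arg_maxnP _ v0 (mem A) (fun v => dep (top v)) v0A) => v vA vmax.
  exists v => //; apply/subsetP => u uA.
  have [tv _] := topP v; have [tu _] := topP u.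
  have [<-|vu] := eqVneq v u; first by move: tv; rewrite inE.
  have /forall_inP/(_ u uA)/implyP/(_ vu) Gvu := cA v vA.
  have [s /andP[vs us]] := td_edge td Gvu.
  have sv : s \in nodes v by rewrite inE.
  have su : s \in nodes u by rewrite inE.
  have [D|ND] := pselect (descends par (top v) (top u)).
    have <- := descends_dep parP D (vmax u uA); by move: tu; rewrite inE.
  have /connectP[q pq Eq] := conn u _ _ su tu; rewrite Eq in ND.
  have [] := path_leaves_subtree parP pq (Dtop v s sv) ND.
  by rewrite inE.
(* [leqSpred] absorbs the truncated predecessor in [td_width]. *)
have bagw t : #|bag t| <= (td_width bag).+1.
  by apply: leq_trans (leqSpred _); exact: leq_bigmax.
apply: (@leq_trans #|\bigcup_(v in V) powerset (bag (top v)) :|: [set set0]|).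
  apply: subset_leq_card; apply/subsetP => A; rewrite !inE => cA.
  have [->|A0] := eqVneq A set0; first by rewrite orbT.
  have [v vA sub] := key A cA A0.
  by apply/orP; left; apply/bigcupP; exists v => //; rewrite inE.
apply: leq_trans (leq_card_setU _ _) _; rewrite cards1 leq_add2r.
apply: (@leq_trans (\sum_(v in V) #|powerset (bag (top v))|)).
  elim/big_rec2: _ => [|v m B _ H]; first by rewrite cards0.
  by apply: leq_trans (leq_card_setU _ _) _; rewrite leq_add2l.
rewrite -sum_nat_const; apply: leq_sum => v _.
by rewrite card_powerset leq_exp2l.
Qed.

(** * The parameterized running time *)

Lemma size_cliques_treewidth (I : scp_instance) :
  size (cliques (nth 0 (scp_encode I)) (scp_n I) (scp_n I))
  <= scp_n I * 2 ^ (treewidth (scp_graph I)).+1 + 1.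
Proof.
rewrite -(size_map (@vertices I)) -(card_uniqP (cliques_uniq (leqnn _))).
have [T [F [bag [td <-]]]] : has_td_of_width (scp_graph I) (treewidth (scp_graph I)).
  by rewrite /treewidth; case: ex_minnP => w /asboolP.
have := card_cliques_td td; rewrite card_ord; apply: leq_trans.
apply: subset_leq_card; apply/subsetP => A /mapP[C HC ->]; rewrite inE.
by have [_ _] := cliques_sound (leqnn _) HC.
Qed.

(** The exponent is w + 1 from the number of cliques, 3p from the target, which is at most 2 8^p,
    and 9 for the constants. *)
Definition fpt_bound (a b : nat) : nat := 2 ^ (a + 3 * b + 10).

Lemma fpt_bound_computable : computable2 fpt_bound.
Proof.
pose c := Do [:: IConst 2 0; ILoad 3 2; IConst 2 1; ILoad 4 2; IAdd 3 3 4; IAdd 3 3 4;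
    IAdd 3 3 4; IConst 4 10; IAdd 3 3 4; IConst 0 1] ;; loop 3 (Do [:: IAdd 0 0 0]).
exists (compile 0 c) => a b; exists (20 + (a + 3 * b + 10) * 6).
apply: wp_outputs; rewrite /c; block.
set s0 := foldl _ _ _.
have [E3 E0] : s0.1 3 = a + 3 * b + 10 /\ s0.1 0 = 1 by rewrite /s0; exec_simpl; split=> //; lia.
clearbody s0.
apply: (wp_weaken (T := (a + 3 * b + 10) * 6 + 1)).
- apply: (wp_loop (I := fun m s => s.1 0 * 2 ^ m = fpt_bound a b) (B := 1)) => //.
  + by rewrite E3 E0 mul1n.
  + move=> m s _ _ _ E; apply: wp_do => //; exec_simpl.
    by rewrite -E expnS; lia.
  + rewrite E3; lia.
- rewrite /=; lia.
by move=> s [_ _]; rewrite muln1.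
Qed.

Lemma scp_cost_bound n p N w : N <= n * 2 ^ w.+1 + 1 ->
  scp_cost n p N <= fpt_bound w p * maxn 1 n ^ 3.
Proof.
set W := 2 ^ w.+1 => HN; set P := 2 ^ p; set x := maxn 1 n.
have W0 : 0 < W by rewrite expn_gt0.
have P0 : 0 < P by rewrite expn_gt0.
have x0 : 0 < x by rewrite leq_max.
have nx : n <= x by rewrite leq_max leqnn orbT.
have pP : p <= P by apply/ltnW/ltn_expl.
have -> : fpt_bound w p = 512 * (P ^ 3 * W).
  rewrite /fpt_bound /P /W -expnM -[512]/(2 ^ 9) -!expnD; congr (2 ^ _); lia.
have tP : target p <= 2 * P ^ 3.
  have E : 4 ^ p = P * P by rewrite -expnMn.
  have H1 : p * (P * P) <= P * (P * P) by rewrite leq_mul2r pP orbT.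
  have H2 : P <= P * (P * P) by rewrite leq_pmulr ?muln_gt0 ?P0.
  have E3 : P ^ 3 = P * (P * P) by rewrite !expnS expn0 muln1.
  rewrite /target E E3 -/P; lia.
have Nx : N <= 2 * (W * x).
  have : n * W <= W * x by rewrite mulnC leq_mul2l nx orbT.
  have : 1 <= W * x by rewrite muln_gt0 W0.
  lia.
(* Each monomial of the cost is at most a small multiple of [Q]; with the coefficients these
   multiples add up to 374, below 512. *)
set Q := P ^ 3 * W * x ^ 3.
have PQ : P <= P ^ 3 by rewrite -{1}(expn1 P) leq_pexp2l.
have P30 : 0 < P ^ 3 by rewrite expn_gt0 P0.
have x30 : 0 < x ^ 3 by rewrite expn_gt0 x0.
have xx : x <= x ^ 3 by rewrite -{1}(expn1 x) leq_pexp2l.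
have Q1 : 1 <= Q by rewrite muln_gt0 x30 andbT muln_gt0 P30.
have Qn : n <= Q.
  apply: leq_trans nx _; apply: leq_trans xx _.
  by rewrite leq_pmull // muln_gt0 P30.
have Qp : p <= Q.
  apply: leq_trans pP _; apply: leq_trans PQ _; rewrite /Q -mulnA.
  by rewrite leq_pmulr // muln_gt0 W0.
have Qnp : n * p <= Q.
  rewrite mulnC; apply: leq_mul; last exact: leq_trans nx xx.
  by apply: leq_trans pP _; apply: leq_trans PQ _; rewrite leq_pmulr.
have QnN : n * N <= 2 * Q.
  apply: leq_trans (leq_mul nx Nx) _.
  have -> : x * (2 * (W * x)) = 2 * (W * x ^ 2) by rewrite !expnS expn0; lia.
  rewrite leq_mul2l /= /Q -mulnA.
  apply: leq_trans (leq_pmull _ P30); rewrite leq_mul2l leq_pexp2l ?orbT //.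
have QnNn : n * (N * n) <= 2 * Q.
  apply: leq_trans (leq_mul nx (leq_mul Nx nx)) _.
  have -> : x * (2 * (W * x) * x) = 2 * (W * x ^ 3) by rewrite !expnS expn0; lia.
  by rewrite leq_mul2l /= /Q -mulnA leq_pmull.
have Qt : target p <= 2 * Q.
  apply: leq_trans tP _; rewrite leq_mul2l /= /Q -mulnA leq_pmulr //.
  by rewrite muln_gt0 W0.
have QtN : target p * N <= 4 * Q.
  apply: leq_trans (leq_mul tP Nx) _.
  have -> : 2 * P ^ 3 * (2 * (W * x)) = 4 * (P ^ 3 * W * x) by lia.
  by rewrite leq_mul2l /= /Q leq_mul2l xx orbT.
have -> : 512 * (P ^ 3 * W) * x ^ 3 = 512 * Q by rewrite -mulnA.
rewrite /scp_cost.
have -> : n * (40 + p * 10 + N * (40 + n * 15))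
  = 40 * n + 10 * (n * p) + 40 * (n * N) + 15 * (n * (N * n)) by lia.
have -> : target p * (30 + N * 12) = 30 * target p + 12 * (target p * N) by lia.
lia.
Qed.

Theorem theorem2 :
  exists (P : program) (g : nat -> nat -> nat) (c : nat),
    computable2 g /\
    forall I : scp_instance,
      outputs_within P (scp_encode I) (scp_time g c I) (nat_of_bool (scp_yes I)).
Proof.
exists (compile 0 scp_program), fpt_bound, 3; split; first exact: fpt_bound_computable.
move=> I; apply: wp_outputs.
apply: wp_weaken (@wp_scp_program (scp_encode I) (scp_n I) (scp_p I) (scp_k I)
  (size_encode I) erefl erefl erefl) _ _.
  exact/scp_cost_bound/size_cliques_treewidth.
by move=> s ->; rewrite scp_yes_knapsack.
Qed.
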